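(* Let $\boldsymbol\gamma=\{\gamma_n\}_{n=0}^{\infty}$ be a sequence of real numbers. Then the following statements are equivalent: (i) $\boldsymbol\gamma$ is CPD and the sequence $\triangle\boldsymbol\gamma=\{\gamma_{n+1}-\gamma_n\}_{n=0}^\infty$ is convergent in $\mathbb{R}$; (ii) there exist a finite Borel measure $\nu$ on $\mathbb{R}$ and $d\in\mathbb{R}$ such that (ii-a) $\nu(\mathbb{R}\setminus(-1,1))=0$, (ii-b) $\frac{1}{1-x}\in L^1(\nu)$, (ii-c) $\gamma_n=\gamma_0+nd-\int_{(-1,1)}\frac{1-x^n}{(1-x)^2}\,\mathrm{d}\nu(x)$ for all $n\in\mathbb{Z}_+$. Moreover, the following statements are satisfied: (iii) if (i) holds and $(b,c,\nu)$ is the representing triplet of $\boldsymbol\gamma$, then $c=0$, $\frac{1}{1-x}\in L^1(\nu)$ and the pair $(d,\nu)$ with $d=b+\int_{(-1,1)}\frac{1}{1-x}\,\mathrm{d}\nu(x)$ is the unique pair satisfying (ii); (iv) if (ii) holds, then $d=\lim_{n\to\infty}(\triangle\boldsymbol\gamma)_n$ and $(b,0,\nu)$ is the representing triplet of $\boldsymbol\gamma$ with $b=d-\int_{(-1,1)}\frac{1}{1-x}\,\mathrm{d}\nu(x)$.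
   Context: $\mathbb{Z}_+=\{0,1,2,\ldots\}$, $\mathbb{R}_+=[0,\infty)$; measures are positive. A real sequence $\{\gamma_n\}_{n=0}^\infty$ is conditionally positive definite (CPD) if $\sum_{i,j=0}^k \gamma_{i+j}\lambda_i\bar\lambda_j\geq 0$ for all finite complex sequences $\lambda_0,\ldots,\lambda_k$ with $\sum_{i=0}^k\lambda_i=0$. Let $Q_0=Q_1=0$ and $Q_n(x)=\sum_{j=0}^{n-2}(n-j-1)x^j$ for $n\geq2$. For a CPD sequence with $\limsup_{n\to\infty}|\gamma_n|^{1/n}<\infty$ there is a unique triplet $(b,c,\nu)$, called its representing triplet, with $b\in\mathbb{R}$, $c\in\mathbb{R}_+$ and $\nu$ a finite compactly supported Borel measure on $\mathbb{R}$ with $\nu(\{1\})=0$, such that $\gamma_n=\gamma_0+bn+cn^2+\int_{\mathbb{R}}Q_n\,\mathrm{d}\nu$ for all $n\in\mathbb{Z}_+$. (Convergence of $\triangle\boldsymbol\gamma$ implies $\limsup_{n\to\infty}|\gamma_n|^{1/n}\leq1$, so in (iii) the representing triplet exists.) *)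

(* Defs.v *)
From HB Require Import structures.
From mathcomp Require Import all_boot all_order all_algebra.
From mathcomp Require Import all_classical all_reals all_analysis.
From mathcomp.real_closed Require Export complex.

Set Implicit Arguments.
Unset Strict Implicit.
Unset Printing Implicit Defensive.

Import Order.TTheory GRing.Theory Num.Theory.
Import numFieldNormedType.Exports.

Local Open Scope classical_set_scope.
Local Open Scope ring_scope.
Local Open Scope complex_scope.

(* In R[i], [0 <= z] means that z is real and nonnegative. *)
Definition cpd (R : realType) (gamma : R^nat) : Prop :=
  forall (k : nat) (lambda : 'I_k.+1 -> R[i]),
    \sum_(i < k.+1) lambda i = 0 ->
    0 <= \sum_(i < k.+1) \sum_(j < k.+1)
           (gamma (i + j)%N)%:C * lambda i * (lambda j)^*.

(* The sum is empty for n = 0 and n = 1. *)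
Definition Q (R : realType) (n : nat) (x : R) : R :=
  \sum_(j < n.-1) (n - j - 1)%:R * x ^+ j.

(* Vanishing outside a compact set; on the real line this is compactness of
   the closed support. *)
Definition compactly_supported (R : realType)
    (nu : {finite_measure set (measurableTypeR R) -> \bar R}) : Prop :=
  exists2 K : set R, compact K & nu (~` K) = 0%E.

(* [representing_triplet gamma b c nu] lists the defining properties of the
   representing triplet (b, c, nu) of gamma. That gamma is conditionally
   positive definite and of at most exponential growth is not part of the
   predicate. The integral is that of a continuous function against a finite
   compactly supported measure, so the real-valued integral is meaningful. *)
Definition representing_triplet (R : realType) (gamma : R^nat) (b c : R)
    (nu : {finite_measure set (measurableTypeR R) -> \bar R}) : Prop :=
  [/\ 0 <= c, compactly_supported nu, nu [set 1] = 0%E &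
      forall n : nat, gamma n =
        gamma 0%N + b * n%:R + c * n%:R ^+ 2 + \int[nu]_x Q n x].

(* The inverse of 0 is 0, but the first clause makes {1} a null set, so the
   value of 1 / (1 - x) at x = 1 is irrelevant. The second clause makes the
   integrand (1 + x + ... + x ^ (n - 1)) / (1 - x) of the third one integrable
   on ]-1, 1[. *)
Definition difference_representation (R : realType) (gamma : R^nat)
    (nu : {finite_measure set (measurableTypeR R) -> \bar R}) (d : R) : Prop :=
  [/\ nu (~` `]-1, 1[) = 0%E,
      nu.-integrable setT (fun x : R => ((1 - x)^-1)%:E) &
      forall n : nat, gamma n =
        gamma 0%N + n%:R * d
        - \int[nu]_(x in `]-1, 1[) ((1 - x ^+ n) / (1 - x) ^+ 2)].

(* Main.v *)
(* A sequence gamma is CPD exactly when its second difference s is positive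
   definite; when the first difference converges, s tends to 0 and in particular
   is bounded.  The functional L on polynomials with L x^n = s n is then
   nonnegative on polynomials that are nonnegative on [-1, 1]: boundedness gives
   L ((1 - x^2) p^2) >= 0, hence L ((1 + x)^a (1 - x)^b) >= 0, and Bernstein
   approximation does the rest.  The infimum F t of L p over the polynomials
   majorizing the indicator of x <= t is a distribution function whose
   Lebesgue-Stieltjes measure nu represents L.  Both this and the uniqueness of
   nu rest on polynomials that approximate indicators of half-lines from above.

   Since s n = int x^n dnu tends to 0, nu lives on ]-1, 1[.  The first
   differences are gamma 1 - gamma 0 + int (1 + ... + x^(n-1)) dnu, so
   their boundedness is the integrability of 1 / (1 - x) (monotone convergence),
   and their limit follows by dominated convergence.  The two integral formulas
   for gamma are exchanged by
   (1 - x^n) / (1 - x)^2 = n / (1 - x) - Q_n x. *)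

Require Import Defs.
From HB Require Import structures.
From mathcomp Require Import all_boot all_order all_algebra.
From mathcomp Require Import all_classical all_reals all_analysis.
From mathcomp Require Import measurable_realfun.
From mathcomp Require Import zify ring lra.

Import Order.TTheory GRing.Theory Num.Theory.
Import numFieldNormedType.Exports.

Local Open Scope classical_set_scope.
Local Open Scope ring_scope.

(** * Polynomial approximation of half-line indicators *)

Section StepPolynomial.
Variable R : realType.
Implicit Types (a b e s t u x : R) (n m : nat).

Lemma bernoulli_ineq (a : R) m : -1 <= a -> 1 + m%:R * a <= (1 + a) ^+ m.
Proof.
move=> a1; elim: m => [|m IH]; first by rewrite mul0r addr0 expr0.
rewrite exprS -[m.+1]addn1 natrD.
have := ler_wpM2l (_ : 0 <= 1 + a) IH.
move=> /(_ ltac:(lra)); apply: le_trans.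
have : 0 <= m%:R * a ^+ 2 by rewrite mulr_ge0 ?sqr_ge0.
nra.
Qed.

Lemma small_expr (a e : R) : 0 <= a < 1 -> 0 < e -> exists n, a ^+ n <= e.
Proof.
move=> /andP[a0 a1] e0.
have a1' : `|a| < 1 by rewrite ger0_norm.
have /cvgrPdist_le /(_ _ e0)[N _ /(_ N)/=] := cvg_expr a1'.
rewrite leqnn sub0r normrN => /(_ isT) h.
by exists N; rewrite (le_trans _ h)// ler_norm.
Qed.

(* [(1 - u ^ n) ^ M] with [M] of order [c ^ - n], where [a < c < b]: by
   Bernoulli's inequality it tends to 1 on [u <= a] and to 0 on [b <= u]. *)
Lemma unit_step_poly a b e : 0 <= a < b -> b <= 1 -> 0 < e ->
  exists p : {poly R}, forall u : R, 0 <= u <= 1 ->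
    (u <= a)%R%:R <= p.[u] <= (u < b)%R%:R + e.
Proof.
move=> /andP[a0 ab] b1 e0.
have [c ac cb] : exists2 c, a < c & c < b by exists ((a + b) / 2); lra.
have c0 : 0 < c by lra.
(* A single exponent [n] separates both [a ^ n] from [c ^ n] and [c ^ n] from [b ^ n] by the factor
   [e / 4]. *)
have [n hn] : exists n, (Num.max (a / c) (c / b)) ^+ n <= e / 4.
  apply: small_expr; last lra.
  have hb : 0 < b by lra.
  have h1 : a / c < 1 by rewrite ltr_pdivrMr// mul1r.
  have h2 : c / b < 1 by rewrite ltr_pdivrMr// mul1r.
  have h3 : 0 <= a / c by rewrite divr_ge0// ltW.
  by rewrite le_max h3 gt_max h1 h2.
have hna : (a / c) ^+ n <= e / 4.
  apply: le_trans hn; rewrite lerXn2r ?nnegrE ?le_max ?lexx//.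
    by rewrite divr_ge0// ltW.
  by rewrite divr_ge0// ltW.
have hnb : (c / b) ^+ n <= e / 4.
  apply: le_trans hn; rewrite lerXn2r ?nnegrE ?le_max ?lexx ?orbT//.
    by rewrite divr_ge0//; lra.
  by rewrite divr_ge0//; lra.
rewrite !expr_div_n in hna hnb.
have cn0 : 0 < c ^+ n by rewrite exprn_gt0.
have bn0 : 0 < b ^+ n by rewrite exprn_gt0//; lra.
rewrite ler_pdivrMr// in hna; rewrite ler_pdivrMr// in hnb.
have [M M1 M2] : exists2 M : nat, 1 <= M%:R * c ^+ n & M%:R * c ^+ n <= 2.
  have cn' : 0 <= c ^- n by rewrite invr_ge0 ltW.
  exists (Num.truncn (c ^- n)).+1.
    rewrite -ler_pdivrMr// div1r; apply/ltW; exact: truncnS_gt.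
  have /andP[h _] := truncn_itv cn'.
  have h2 : c ^+ n <= 1 by rewrite exprn_ile1 ?ltW//; lra.
  rewrite -addn1 natrD mulrDl mul1r.
  have := ler_wpM2r (ltW cn0) h; rewrite mulVf ?gt_eqF//; lra.
pose p0 : {poly R} := (1 - 'X^n) ^+ M.
have p0E u : p0.[u] = (1 - u ^+ n) ^+ M.
  by rewrite horner_exp !hornerE.
(* The shift [e / 2] pays for the loss [M a ^ n <= e / 2] in Bernoulli's inequality on [u <= a]. *)
exists (p0 + (e / 2)%:P) => u /andP[u0 u1].
rewrite hornerD hornerC p0E.
have un0 : 0 <= u ^+ n by rewrite exprn_ge0.
have un1 : u ^+ n <= 1 by rewrite exprn_ile1.
have P0 : 0 <= (1 - u ^+ n) ^+ M by rewrite exprn_ge0//; lra.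
have P1 : (1 - u ^+ n) ^+ M <= 1 by rewrite exprn_ile1//; lra.
apply/andP; split.
  case: (leP u a) => [ua|_]; last by rewrite /=; lra.
  have ua' : u ^+ n <= a ^+ n by rewrite lerXn2r ?nnegrE.
  have := @bernoulli_ineq (- u ^+ n) M; rewrite lerN2 => /(_ un1).
  have Mua : M%:R * u ^+ n <= M%:R * (e / 4 * c ^+ n).
    by rewrite ler_wpM2l// (le_trans ua').
  have : e / 4 * (M%:R * c ^+ n) <= e / 4 * 2 by rewrite ler_wpM2l//; lra.
  by rewrite /= ?mulr1n; lra.
case: (ltP u b) => [_|bu]; first by rewrite /= ?mulr1n; lra.
have ub : b ^+ n <= u ^+ n.
  by rewrite lerXn2r ?nnegrE//; lra.
(* The product of [(1 - u ^ n) ^ M] and [(1 + u ^ n) ^ M] is at most 1, so the growth of the second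
   factor bounds the first one by [1 / (M u ^ n)]. *)
have h1 : 1 + M%:R * u ^+ n <= (1 + u ^+ n) ^+ M.
  by apply: bernoulli_ineq; lra.
have h2 : (1 - u ^+ n) ^+ M * (1 + u ^+ n) ^+ M <= 1.
  rewrite -exprMn exprn_ile1//; nra.
have h3 : (1 - u ^+ n) ^+ M * (M%:R * u ^+ n) <= 1.
  apply: le_trans h2; rewrite ler_wpM2l//; lra.
(* [M u ^ n >= M b ^ n >= (4 / e) M c ^ n >= 4 / e] *)
have h4 : 1 <= e / 4 * (M%:R * u ^+ n).
  have : M%:R * c ^+ n <= M%:R * (e / 4 * b ^+ n) by rewrite ler_wpM2l.
  have : e / 4 * (M%:R * b ^+ n) <= e / 4 * (M%:R * u ^+ n).
    by rewrite ler_wpM2l//; [lra|rewrite ler_wpM2l].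
  lra.
have h5 : (1 - u ^+ n) ^+ M * 1 <=
    (1 - u ^+ n) ^+ M * (e / 4 * (M%:R * u ^+ n)).
  by rewrite ler_wpM2l.
have : e / 4 * ((1 - u ^+ n) ^+ M * (M%:R * u ^+ n)) <= e / 4 * 1.
  by rewrite ler_wpM2l//; lra.
rewrite /= ?mulr0n; lra.
Qed.

(** The affine change [u = (1 + x) / 2] reduces this to the unit interval. When [s < -1] or [1 < t],
    one of the indicators is constant on [[-1, 1]] and a constant polynomial suffices. *)
Lemma step_poly s t e : s < t -> 0 < e ->
  exists p : {poly R}, forall x : R, -1 <= x <= 1 ->
    (x <= s)%R%:R <= p.[x] <= (x < t)%R%:R + e.
Proof.
move=> st e0.
have [s1|s1] := ltP s (-1).
  exists 0 => x /andP[x1 _]; rewrite horner0.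
  by rewrite [x <= s]leNgt (lt_le_trans s1 x1) lexx addr_ge0 ?ler0n ?ltW.
have [t1|t1] := ltP 1 t.
  exists 1 => x /andP[_ x1]; rewrite hornerC (le_lt_trans x1 t1).
  apply/andP; split; first by case: (x <= s).
  by rewrite lerDl ltW.
have [p hp] := @unit_step_poly ((1 + s) / 2) ((1 + t) / 2) e
  ltac:(apply/andP; lra) ltac:(lra) e0.
exists (p \Po (2^-1 *: (1 + 'X))) => x /andP[x1 x2].
rewrite horner_comp !hornerE.
have := hp (2^-1 * (1 + x)) ltac:(apply/andP; lra).
have -> : (2^-1 * (1 + x) <= (1 + s) / 2) = (x <= s) by apply/idP/idP; lra.
by have -> : (2^-1 * (1 + x) < (1 + t) / 2) = (x < t) by apply/idP/idP; lra.
Qed.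

End StepPolynomial.

(** * Positivity of functionals on polynomials *)

Section BernsteinPositivity.
Variable R : realType.

(** Both sides are the trinomial coefficient [n! / (i! j! (n - i - j)!)]. *)
Lemma mul_bin_trinomial n i j : (i + j <= n)%N ->
  ('C(i + j, j) * 'C(n, i + j) = 'C(n, j) * 'C(n - j, i))%N.
Proof.
move=> ijn; have jn : (j <= n)%N by apply: leq_trans ijn; exact: leq_addl.
have inj : (i <= n - j)%N by rewrite leq_subRL// addnC.
apply/eqP; rewrite -(@eqn_pmul2r (j`! * i`! * (n - (i + j))`!)); last first.
  by rewrite !muln_gt0 !fact_gt0.
apply/eqP; transitivity n`!.
  rewrite -(bin_fact ijn) -(bin_fact (leq_addl i j)) addnK; ring.
rewrite -(bin_fact jn) -(bin_fact inj) -subnDA [(j + i)%N]addnC; ring.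
Qed.

(** After the shift [k = i + j], the trinomial identity pulls ['C(n, j)] out of the sum and leaves
    the expansion of [((1 - 'X) + 'X) ^ (n - j) = 1]. *)
Lemma bernstein_binomial n j : (j <= n)%N ->
  \sum_(k < n.+1) ('C(k, j) * 'C(n, k))%:R *: ('X^k * (1 - 'X) ^+ (n - k)) =
  'C(n, j)%:R *: 'X^j :> {poly R}.
Proof.
move=> jn; rewrite -(big_mkord xpredT
  (fun k => ('C(k, j) * 'C(n, k))%:R *: ('X^k * (1 - 'X) ^+ (n - k)) : {poly R})).
rewrite (big_cat_nat (n := j))//=; last exact: leqW.
rewrite big_nat big1 ?add0r; last first.
  by move=> k /= kj; rewrite bin_small// mul0n scale0r.
rewrite -{1}[j]add0n big_addn subSn// big_mkord.
transitivity ('C(n, j)%:R *: ('X^j * ((1 - 'X) + 'X) ^+ (n - j)) : {poly R});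
  last by rewrite subrK expr1n mulr1.
rewrite exprDn mulr_sumr scaler_sumr; apply: eq_bigr => -[i /= ilt] _.
rewrite mul_bin_trinomial; last by lia.
rewrite natrM -scalerA [(n - (i + j))%N](_ : _ = (n - j - i)%N); last by lia.
congr (_ *: _); rewrite -mulrnAr scaler_nat exprD -!mulrnAr; ring.
Qed.

(* [C(k, j) / C(n, j)] is a product of [j] factors close to [k / n], so the
   Bernstein weights integrate [(k / n) ^ j] to nearly [L 'X^j]. *)
Lemma bin_ratio_approx n k d j : (j <= d)%N -> (d < n)%N -> (k <= n)%N ->
  `| 'C(k, j)%:R / 'C(n, j)%:R - (k%:R / n%:R) ^+ j |
    <= j%:R * (d%:R / (n - d)%:R) :> R.
Proof.
move=> jd dn kn; have n0 : 0 < n%:R :> R by rewrite ltr0n; lia.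
have y0 : 0 <= k%:R / n%:R :> R by rewrite divr_ge0.
have y1 : k%:R / n%:R <= 1 :> R by rewrite ler_pdivrMr// mul1r ler_nat.
elim: j jd => [|j IH] jd; first by rewrite !bin0 expr0 divr1 subrr normr0 mul0r.
have {}IH := IH (ltnW jd).
set a := 'C(k, j)%:R / 'C(n, j)%:R in IH *.
have C0 : 0 < 'C(n, j)%:R :> R.
  by rewrite ltr0n bin_gt0 (leq_trans (ltnW jd) (ltnW dn)).
have a0 : 0 <= a by rewrite divr_ge0.
have a1 : a <= 1 by rewrite ler_pdivrMr// mul1r ler_nat leq_bin2l.
have nj0 : 0 < n%:R - j%:R :> R.
  by rewrite subr_gt0 ltr_nat (leq_trans jd (ltnW dn)).
have nd0 : 0 < n%:R - d%:R :> R by rewrite subr_gt0 ltr_nat.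
have binS i : j.+1%:R * 'C(i, j.+1)%:R = (i%:R - j%:R) * 'C(i, j)%:R :> R.
  rewrite -natrM mul_bin_left natrM; have [ji|ij] := leqP j i.
    by rewrite natrB.
  by rewrite bin_small// !mulr0.
have aS : 'C(k, j.+1)%:R / 'C(n, j.+1)%:R =
          a * ((k%:R - j%:R) / (n%:R - j%:R)) :> R.
  have j1 : j.+1%:R != 0 :> R by rewrite pnatr_eq0.
  have CS : 'C(n, j.+1)%:R != 0 :> R.
    by rewrite pnatr_eq0 -lt0n bin_gt0 (leq_trans jd (ltnW dn)).
  rewrite -[LHS](mulKf j1) [_ * (_ / _)]mulrA binS.
  rewrite -[X in _ / X](mulKf j1) binS /a.
  by field; rewrite ?gt_eqF//=; apply/and4P.
rewrite aS exprS.
have -> : a * ((k%:R - j%:R) / (n%:R - j%:R)) - k%:R / n%:R * (k%:R / n%:R) ^+ j =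
   a * ((k%:R - j%:R) / (n%:R - j%:R) - k%:R / n%:R) +
   k%:R / n%:R * (a - (k%:R / n%:R) ^+ j) by ring.
apply: (le_trans (ler_normD _ _)); rewrite -natr1 [leRHS]mulrDl mul1r addrC.
apply: lerD.
  rewrite normrM ger0_norm//; apply: le_trans (IH).
  by rewrite ler_piMl.
rewrite normrM (ger0_norm a0).
have -> : (k%:R - j%:R) / (n%:R - j%:R) - k%:R / n%:R =
   - ((1 - k%:R / n%:R) * (j%:R / (n%:R - j%:R))) :> R.
  by field; rewrite !gt_eqF.
have h : 0 <= j%:R / (n%:R - j%:R) :> R by rewrite divr_ge0// ltW.
rewrite normrN ger0_norm; last by rewrite mulr_ge0// subr_ge0.
apply: (@le_trans _ R (j%:R / (n%:R - j%:R))).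
  have h' : (1 - k%:R / n%:R) * (j%:R / (n%:R - j%:R)) <= j%:R / (n%:R - j%:R) :> R.
    by rewrite ler_piMl// gerBl.
  by rewrite (le_trans _ h')// ler_piMl// mulr_ge0// subr_ge0.
have jd' : j%:R <= d%:R :> R by rewrite ler_nat ltnW.
rewrite (natrB _ (ltnW dn)); apply: ler_pM => //.
  by rewrite invr_ge0 ltW.
by rewrite lef_pV2 ?posrE// lerD2l lerN2.
Qed.

(** The Archimedean property; it closes estimates with an error of order [1 / m] without taking
    limits. *)
Lemma ge0_of_inv_bound (x C : R) : (forall m, - (C / m.+1%:R) <= x) -> 0 <= x.
Proof.
move=> h; rewrite leNgt; apply/negP => x0.
have := h (Num.truncn (C / - x)); rewrite lerNl ler_pdivlMr ?ltr0n//.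
rewrite leNgt => /negP; apply.
by rewrite mulrC -ltr_pdivrMr ?oppr_gt0// truncnS_gt.
Qed.

(** Up to an error of order [1 / n], [L p] is the sum of the values [p (k / n)] against the
    nonnegative weights [w k], whose total mass is [L 1]. *)
Lemma bernstein_ge0 (L : {scalar {poly R}}) (p : {poly R}) :
  (forall a b, 0 <= L ('X^a * (1 - 'X) ^+ b)) ->
  (forall x : R, 0 <= x <= 1 -> 0 <= p.[x]) -> 0 <= L p.
Proof.
move=> L0 p0; pose d := size p.
(* [C] collects the coefficients of [p], the mass [L 1], and [d * d] as a bound for the factor
   [j * d] in [bin_ratio_approx]. *)
pose C := (\sum_(j < d) `|p`_j|) * (d%:R * d%:R) * L 1.
apply: (@ge0_of_inv_bound _ C) => m.
(* This choice makes [n - d] equal to [m.+1], the denominator of the error. *)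
pose n := (d + m.+1)%N.
pose w k := 'C(n, k)%:R * L ('X^k * (1 - 'X) ^+ (n - k)).
have w0 k : 0 <= w k by rewrite mulr_ge0.
have LX j : (j <= d)%N ->
    L 'X^j = \sum_(k < n.+1) w k * ('C(k, j)%:R / 'C(n, j)%:R).
  move=> jd; have jn : (j <= n)%N by rewrite (leq_trans jd)// leq_addr.
  have Cn : 'C(n, j)%:R != 0 :> R by rewrite pnatr_eq0 -lt0n bin_gt0.
  apply: (mulfI Cn); rewrite -scalarZ -bernstein_binomial// linear_sum mulr_sumr.
  apply: eq_bigr => k _; rewrite scalarZ /w natrM; field; exact: Cn.
have sw : \sum_(k < n.+1) w k = L 1.
  rewrite -(expr0 'X) (LX 0%N)//; apply: eq_bigr => k _.
  by rewrite !bin0 divr1 mulr1.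
pose e := d%:R * d%:R / m.+1%:R : R.
have Lp : L p = \sum_(k < n.+1) w k *
    \sum_(j < d) p`_j * ('C(k, j)%:R / 'C(n, j)%:R).
  rewrite -[p in LHS]coefK poly_def linear_sum.
  under eq_bigr => j _ do rewrite scalarZ LX ?mulr_sumr 1?ltnW//.
  rewrite exchange_big/=; apply: eq_bigr => k _; rewrite mulr_sumr.
  by apply: eq_bigr => j _; ring.
have -> : C / m.+1%:R = \sum_(k < n.+1) w k * ((\sum_(j < d) `|p`_j|) * e).
  by rewrite -mulr_suml sw /C /e; ring.
rewrite Lp -sumrN; apply: ler_sum => k _; rewrite -mulrN ler_wpM2l//.
have kn : (k <= n)%N by rewrite -ltnS.
have n0 : 0 < n%:R :> R by rewrite ltr0n /n; lia.
have : 0 <= p.[k%:R / n%:R].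
  by apply: p0; rewrite divr_ge0//= ler_pdivrMr// mul1r ler_nat.
rewrite horner_coef -/d => pk.
rewrite -subr_ge0 opprK; apply: (le_trans pk).
rewrite mulr_suml -big_split/=; apply: ler_sum => j _.
have := @bin_ratio_approx n k d j (ltnW (ltn_ord j)) ltac:(rewrite /n; lia) kn.
rewrite {2}/n addKn => h.
have h2 : `|'C(k, j)%:R / 'C(n, j)%:R - (k%:R / n%:R) ^+ j| <= e :> R.
  apply: (le_trans h); rewrite /e -mulrA ler_wpM2r ?divr_ge0//.
  by rewrite ler_nat ltnW.
have h3 := ler_wpM2l (normr_ge0 p`_j) h2.
rewrite -normrM in h3; move: h3; rewrite ler_norml => /andP[+ _].
rewrite mulrBr; lra.
Qed.

End BernsteinPositivity.

(** * Functionals given by moments, and conditional positive definiteness *)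

Section MomentFunctional.
Variable R : realType.
Implicit Types (s : R^nat) (p q : {poly R}).

(** The Riesz functional of the sequence [s]. *)
Definition moment_functional s p : R := \sum_(i < size p) p`_i * s i.

Lemma moment_functional_widen s p n : (size p <= n)%N ->
  moment_functional s p = \sum_(i < n) p`_i * s i.
Proof.
move=> pn; rewrite /moment_functional (big_ord_widen n (fun i => p`_i * s i))//.
rewrite big_mkcond/=; apply: eq_bigr => i _; case: ltnP => // pi.
by rewrite nth_default ?mul0r.
Qed.

Lemma moment_functional_is_scalar s : scalar (moment_functional s).
Proof.
move=> a p q; pose n := maxn (size p) (size q).
have pn : (size p <= n)%N by exact: leq_maxl.
have qn : (size q <= n)%N by exact: leq_maxr.
have pqn : (size (a *: p + q)%R <= n)%N.
  rewrite (leq_trans (size_polyD _ _))// geq_max qn andbT.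
  exact: leq_trans (size_scale_leq _ _) pn.
rewrite !(@moment_functional_widen s _ n)// mulr_sumr -big_split/=.
by apply: eq_bigr => i _; rewrite coefD coefZ; ring.
Qed.

HB.instance Definition _ s :=
  GRing.isLinear.Build R {poly R} R *%R (moment_functional s)
    (moment_functional_is_scalar s).

Lemma moment_functionalXn s n : moment_functional s 'X^n = s n.
Proof.
rewrite (@moment_functional_widen s _ n.+1) ?size_polyXn//.
rewrite big_ord_recr/= coefXn eqxx mul1r big1 ?add0r// => i _.
by rewrite coefXn ltn_eqF ?mul0r.
Qed.

Lemma scalar_polyE (L : {scalar {poly R}}) p :
  L p = moment_functional (fun n => L 'X^n) p.
Proof.
rewrite -[p in LHS]coefK poly_def linear_sum.
by apply: eq_bigr => i _; rewrite scalarZ.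
Qed.

(** Turns the Hankel forms of [cpd] into values of the functional at products of polynomials. *)
Lemma moment_functionalM s n (a b : 'I_n -> R) :
  moment_functional s
    ((\sum_(i < n) a i *: 'X^i) * (\sum_(i < n) b i *: 'X^i)) =
  \sum_(i < n) \sum_(j < n) s (i + j)%N * (a i * b j).
Proof.
rewrite mulr_suml linear_sum; apply: eq_bigr => i _.
rewrite mulr_sumr linear_sum; apply: eq_bigr => j _.
rewrite -scalerAl -scalerAr -exprD !scalarZ/= moment_functionalXn; ring.
Qed.

Definition second_diff s : R^nat := fun n => s n.+2 - s n.+1 *+ 2 + s n.

(** Multiplication by [('X - 1) ^ 2] is dual to taking second differences. *)
Lemma moment_functional_second_diff s p :
  moment_functional s (('X - 1) ^+ 2 * p) = moment_functional (second_diff s) p.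
Proof.
rewrite -[p in LHS]coefK poly_def mulr_sumr linear_sum.
apply: eq_bigr => i _; rewrite -scalerAr scalarZ; congr (_ * _).
have -> : ('X - 1) ^+ 2 * 'X^i = 'X^(i.+2) - 'X^(i.+1) *+ 2 + 'X^i :> {poly R}.
  by rewrite !exprS; ring.
by rewrite linearD linearB linearMn/= !moment_functionalXn.
Qed.

Lemma complex_conjE (z : R[i]%C) : z^* = (z^*)%C.
Proof. by []. Qed.

(** Coefficient vectors of sum zero are those of polynomials vanishing at 1, that is, of multiples
    of ['X - 1]; the resulting factor [('X - 1) ^ 2] passes to the second difference. *)
Lemma cpdP s :
  cpd s <-> forall q, 0 <= moment_functional (second_diff s) (q ^+ 2).
Proof.
split=> [H q|H k l l0].
  pose p := ('X - 1) * q.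
  have -> : moment_functional (second_diff s) (q ^+ 2) =
            moment_functional s (p * p).
    by rewrite -moment_functional_second_diff; congr moment_functional;
       rewrite /p; ring.
  (* [cpd] sums over ['I_k.+1]; with [k] equal to [size p], the last coefficient is 0. *)
  have pE : p = \sum_(i < (size p).+1) p`_i *: 'X^i.
    by rewrite big_ord_recr/= nth_default// scale0r addr0 -poly_def coefK.
  have p1 : p.[1] = 0 by rewrite /p !hornerE subrr mul0r.
  have := H (size p) (fun i => (p`_i)%:C%C).
  rewrite -raddf_sum/=.
  have -> : \sum_(i < (size p).+1) p`_i = 0.
    rewrite -[RHS]p1 [p in RHS]pE horner_sum.
    by apply: eq_bigr => i _; rewrite hornerZ hornerXn expr1n mulr1.
  move=> /(_ erefl); rewrite [X in _ -> _ <= moment_functional _ X](_ : _ =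
    (\sum_(i < (size p).+1) p`_i *: 'X^i) * (\sum_(i < (size p).+1) p`_i *: 'X^i)); last first.
    by rewrite -pE.
  rewrite moment_functionalM.
  under eq_bigr => i _ do under eq_bigr => j _ do
    rewrite /= complex_conjE conjc_real -!rmorphM -mulrA.
  under eq_bigr => i _ do rewrite -raddf_sum.
  by rewrite -raddf_sum/= lecR.
pose a i := complex.Re (l i); pose b i := complex.Im (l i).
pose A := \sum_(i < k.+1) a i *: 'X^i : {poly R}.
pose B := \sum_(i < k.+1) b i *: 'X^i : {poly R}.
have root1 (f : 'I_k.+1 -> R) : \sum_i f i = 0 ->
    exists q, \sum_(i < k.+1) f i *: 'X^i = ('X - 1) * q :> {poly R}.
  move=> f0; have : root (\sum_(i < k.+1) f i *: 'X^i) 1.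
    apply/rootP; rewrite horner_sum -[RHS]f0; apply: eq_bigr => i _.
    by rewrite hornerZ hornerXn expr1n mulr1.
  by move=> /factor_theorem[q ->]; exists q; rewrite mulrC.
have pos (f : 'I_k.+1 -> R) : \sum_i f i = 0 ->
    0 <= moment_functional s ((\sum_(i < k.+1) f i *: 'X^i) * (\sum_(i < k.+1) f i *: 'X^i)).
  move=> /root1[q ->].
  by rewrite [X in moment_functional _ X](_ : _ = ('X - 1) ^+ 2 * q ^+ 2)
    ?moment_functional_second_diff//; ring.
have a0 : \sum_i a i = 0 by rewrite -raddf_sum l0.
have b0 : \sum_i b i = 0 by rewrite -raddf_sum l0.
(* The imaginary part of [l i * (l j)^*] is [b i * a j - a i * b j], which cancels in the double
   sum; the real part [a i * a j + b i * b j] splits into two real forms. *)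
rewrite lecE; apply/andP; split.
  rewrite raddf_sum/=.
  under eq_bigr => i _ do rewrite raddf_sum/=.
  rewrite (_ : \sum_i _ = moment_functional s (B * A) - moment_functional s (A * B)).
    by rewrite mulrC subrr.
  rewrite !moment_functionalM -sumrB; apply: eq_bigr => i _.
  rewrite -sumrB; apply: eq_bigr => j _; rewrite /a /b complex_conjE.
  by case: (l i) (l j) => [x y] [z t]/=; ring.
rewrite raddf_sum/=.
under eq_bigr => i _ do rewrite raddf_sum/=.
rewrite (_ : \sum_i _ = moment_functional s (A * A) + moment_functional s (B * B)).
  by rewrite addr_ge0 ?pos.
rewrite !moment_functionalM -big_split; apply: eq_bigr => i _.
rewrite -big_split; apply: eq_bigr => j _; rewrite /a /b complex_conjE.
by case: (l i) (l j) => [x y] [z t]/=; ring.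
Qed.

End MomentFunctional.

(** * From positivity on squares to positivity on [[-1, 1]] *)

Section PositivityOnInterval.
Variable R : realType.

(* [a m := L (x ^ 2m p ^ 2)] is convex in [m], since its second difference is
   [L] of a square; a bounded convex sequence is nonincreasing. *)
Lemma square_bounded_ge0 (L : {scalar {poly R}}) (C : R) :
  (forall q, 0 <= L (q ^+ 2)) -> (forall n, `|L 'X^n| <= C) ->
  forall p, 0 <= L ((1 - 'X ^+ 2) * p ^+ 2).
Proof.
move=> L0 LC p; pose a m := L ('X^(2 * m) * p ^+ 2).
have [D aD] : exists D, forall m, a m <= D.
  exists (\sum_(i < size (p ^+ 2)) `|(p ^+ 2)`_i| * C) => m.
  rewrite /a -[p ^+ 2 in leLHS]coefK poly_def mulr_sumr linear_sum.
  apply: ler_sum => i _; rewrite -scalerAr scalarZ -exprD.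
  apply: (le_trans (ler_norm _)); by rewrite normrM ler_wpM2l.
have cvx m : 0 <= a m.+2 - a m.+1 *+ 2 + a m.
  rewrite (_ : _ + _ = L (('X^m * (1 - 'X ^+ 2) * p) ^+ 2)) ?L0//.
  rewrite /a -linearMn -linearB -linearD; congr (L _).
  have e k : 'X^(2 * (m + k)) = 'X^m ^+ 2 * 'X^(2 * k) :> {poly R}.
    by rewrite mulnDr exprD mulnC exprM.
  rewrite -[m.+2]addn2 -[m.+1]addn1 -[in X in _ + X](addn0 m) !e; ring.
have mono m : a 1%N - a 0%N <= a m.+1 - a m.
  by elim: m => // m IH; apply: le_trans IH _; have := cvx m; lra.
have lin m : a 0%N + m%:R * (a 1%N - a 0%N) <= a m.
  elim: m => [|m IH]; first by rewrite mul0r addr0.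
  by rewrite -natr1; have := mono m; lra.
have -> : L ((1 - 'X ^+ 2) * p ^+ 2) = a 0%N - a 1%N.
  by rewrite /a -linearB; congr (L _); rewrite muln0 expr0 muln1; ring.
(* By convexity [a m] lies above the line through its first two values, so the bound [D] gives
   [m (a 0 - a 1) >= a 0 - D]. *)
apply: (@ge0_of_inv_bound _ _ (D - a 0%N)) => m.
rewrite lerNl ler_pdivlMr ?ltr0n//.
by have := lin m.+1; have := aD m.+1; lra.
Qed.

(** By parity of the exponents, [(1 + 'X) ^ a * (1 - 'X) ^ b] is a square times one of [1],
    [1 + 'X], [1 - 'X] and [1 - 'X ^ 2]. Positivity on these products is what Bernstein's argument
    requires, after transport to the unit interval. *)
Lemma ge0_on_itv (L : {scalar {poly R}}) (C : R) :
  (forall q, 0 <= L (q ^+ 2)) -> (forall n, `|L 'X^n| <= C) ->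
  forall p : {poly R}, (forall x : R, -1 <= x <= 1 -> 0 <= p.[x]) -> 0 <= L p.
Proof.
move=> L0 LC p p0.
have W := @square_bounded_ge0 L C L0 LC.
have pos a b : 0 <= L ((1 + 'X) ^+ a * (1 - 'X) ^+ b).
  have evenodd n : exists (e : bool) m, n = (e + m * 2)%N.
    by exists (odd n), n./2; rewrite muln2 odd_double_half.
  have [e [m ->]] := evenodd a; have [f [k ->]] := evenodd b.
  rewrite !exprD !exprM mulrACA -!exprMn; set q := (_ ^+ m * _ ^+ k).
  (* [1 + 'X] is half of [(1 + 'X) ^ 2 + (1 - 'X ^ 2)], and likewise for [1 - 'X]. *)
  have h1 : L ((1 + 'X) * q ^+ 2) =
      2^-1 * (L (((1 + 'X) * q) ^+ 2) + L ((1 - 'X ^+ 2) * q ^+ 2)).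
    rewrite -linearD -scalarZ; congr (L _).
    rewrite -[LHS]scale1r -[1 in LHS](@mulVf _ 2)// -scalerA; congr (_ *: _).
    by rewrite scaler_nat; ring.
  have h2 : L ((1 - 'X) * q ^+ 2) =
      2^-1 * (L (((1 - 'X) * q) ^+ 2) + L ((1 - 'X ^+ 2) * q ^+ 2)).
    rewrite -linearD -scalarZ; congr (L _).
    rewrite -[LHS]scale1r -[1 in LHS](@mulVf _ 2)// -scalerA; congr (_ *: _).
    by rewrite scaler_nat; ring.
  case: e f => [] []; rewrite ?expr1 ?expr0 ?mul1r ?mulr1 ?h1 ?h2 ?L0//.
  - by rewrite (_ : (1 + 'X) * (1 - 'X) = 1 - 'X ^+ 2)//; ring.
  - by rewrite mulr_ge0 ?invr_ge0 ?addr_ge0.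
  - by rewrite mulr_ge0 ?invr_ge0 ?addr_ge0.
(* Since [1 - phi] is [(1 - 'X) / 2], the functional [L'] takes on Bernstein products positive
   multiples of the values bounded in [pos]. *)
pose phi : {poly R} := 2^-1 *: (1 + 'X).
have phi_scalar : scalar (fun q : {poly R} => L (q \Po phi)).
  by move=> a u v; rewrite comp_polyD comp_polyZ linearP.
pose L' := HB.pack (fun q : {poly R} => L (q \Po phi))
  (GRing.isLinear.Build R {poly R} R *%R _ phi_scalar) : {scalar {poly R}}.
have -> : L p = L' (p \Po (2%:P * 'X - 1)).
  rewrite /L'/= -comp_polyA; congr (L _); rewrite -[p in LHS]comp_polyXr.
  congr (_ \Po _); rewrite /phi comp_polyB comp_polyM comp_polyC comp_polyX.
  by rewrite mul_polyC scalerA mulfV// scale1r comp_polyC; ring.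
apply: bernstein_ge0 => [a b|x /andP[x0 x1]]; last first.
  by rewrite horner_comp !hornerE p0//; apply/andP; lra.
rewrite /L'/= comp_polyM comp_Xn_poly rmorphXn/= comp_polyB comp_polyX comp_polyC.
rewrite (_ : 1%:P - phi = 2^-1 *: (1 - 'X)).
  by rewrite /phi !exprZn -scalerAl -scalerAr !scalarZ !mulr_ge0// exprn_ge0.
rewrite /phi -[1%:P]scale1r -[X in X *: _](@mulVf _ 2)// -scalerA -scalerBr.
by congr (_ *: _); rewrite scaler_nat; ring.
Qed.

End PositivityOnInterval.

(** * Distribution functions of functionals *)

Section DistributionFunction.
Variable R : realType.
Implicit Types (F : R -> R) (p q : {poly R}) (x : R).

(* [F t] plays the role of [L] applied to the indicator of [x <= t], on
   [-1, 1]; polynomials only see this indicator through the two bounds. *)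
Definition distribution_function (L : {poly R} -> R) F : Prop :=
  (forall t p, (forall x : R, -1 <= x <= 1 -> (x <= t)%R%:R <= p.[x]) ->
    F t <= L p) /\
  (forall t e p, (forall x : R, -1 <= x <= 1 -> p.[x] <= (x <= t)%R%:R + e) ->
    L p <= F t + e * L 1).

(** At [t = -2] the indicator vanishes on [[-1, 1]], so [F (-2)] is at most [L 0] and at least
    [L (- p)]. *)
Lemma distribution_function_ge0 (L : {scalar {poly R}}) F p :
  distribution_function L F ->
  (forall x : R, -1 <= x <= 1 -> 0 <= p.[x]) -> 0 <= L p.
Proof.
move=> [lo hi] p0.
have no (x : R) : -1 <= x -> (x <= -2) = false :> bool.
  by move=> x1; apply/negbTE; rewrite -ltNge; lra.
have : F (-2) <= L 0.
  by apply: lo => x /andP[x1 _]; rewrite horner0 no.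
have : L (- p) <= F (-2) + 0 * L 1.
  apply: hi => x /andP[x1 x2].
  by rewrite hornerN no// add0r oppr_le0 p0// x1.
by rewrite linearN linear0/= mul0r; lra.
Qed.

Lemma distribution_function_le (L : {scalar {poly R}}) F p q :
  distribution_function L F ->
  (forall x : R, -1 <= x <= 1 -> p.[x] <= q.[x]) -> L p <= L q.
Proof.
move=> LF pq; rewrite -subr_ge0 -linearB.
apply: (distribution_function_ge0 _ _ _ LF) => x x1.
by rewrite hornerD hornerN subr_ge0 pq.
Qed.

Lemma distribution_function1 (L : {scalar {poly R}}) F t :
  distribution_function L F -> 1 <= t -> F t = L 1.
Proof.
move=> [lo hi] t1; apply/eqP; rewrite eq_le; apply/andP; split.
  apply: lo => x /andP[_ x1]; rewrite hornerC.
  by rewrite (le_trans x1 t1).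
have := hi t 0 1; rewrite mul0r addr0; apply=> x /andP[_ x1].
by rewrite hornerC (le_trans x1 t1) addr0.
Qed.

Lemma distribution_function_nneg (L : {scalar {poly R}}) F t :
  distribution_function L F -> 0 <= F t.
Proof.
move=> [lo hi]; have := hi t 0 0; rewrite linear0 mul0r addr0; apply=> x _.
by rewrite horner0 addr0.
Qed.

(** The sum counts the integers in [[y, N[], of which there are [N] minus the ceiling of [y]. *)
Lemma sum_ge_indic N (y : R) : 0 <= y <= N%:R ->
  N%:R - y - 1 <= \sum_(i < N) (y <= i%:R)%R%:R <= N%:R - y.
Proof.
elim: N => [|N IH] /andP[y0 yN].
  by rewrite big_ord0; apply/andP; lra.
rewrite big_ord_recr/=; have [yN'|yN'] := leP y N%:R.
  have /andP[h1 h2] := IH ltac:(by rewrite y0).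
  by rewrite /= -natr1; apply/andP; lra.
rewrite big1 => [|i _]; last first.
  by rewrite leNgt (le_lt_trans _ yN')// ler_nat ltnW.
by rewrite -natr1 in yN *; rewrite addr0; apply/andP; lra.
Qed.

Lemma sum_shift (f : nat -> R) N :
  \sum_(i < N) f i.+1 + f 0%N = \sum_(i < N) f i + f N.
Proof.
transitivity (\sum_(i < N.+1) f i); last by rewrite big_ord_recr.
by rewrite big_ord_recl addrC.
Qed.

Definition unit_map : {poly R} := 2^-1 *: (1 + 'X).

Lemma horner_unit_map x : unit_map.[x] = (1 + x) / 2.
Proof. by rewrite !hornerE mulrC. Qed.

(* Layer-cake approximation of the nonincreasing function [1 - u ^ j],
   [u = (1 + x) / 2], by the indicators of [x <= t i], where [u ^ j = i / N]
   at [t i]. *)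
Lemma distribution_function_layers (L : {scalar {poly R}}) F j N (t : nat -> R) :
  distribution_function L F -> (0 < N)%N -> (0 < j)%N ->
  (forall i, (i <= N)%N ->
    -1 <= t i <= 1 /\ N%:R * ((1 + t i) / 2) ^+ j = i%:R) ->
  `|N%:R * L (1 - unit_map ^+ j) - \sum_(i < N) F (t i)| <= 3 * L 1.
Proof.
move=> LF N0 j0 tP; have [lo hi] := LF.
have NR : 0 < N%:R :> R by rewrite ltr0n.
pose u (x : R) := (1 + x) / 2.
have le_tE x i : (i <= N)%N -> -1 <= x -> (x <= t i) = (N%:R * u x ^+ j <= i%:R).
  move=> iN x1; have [/andP[t1 _] <-] := tP i iN.
  rewrite ler_pM2l// ler_pXn2r ?nnegrE//; rewrite /u; lra.
have tlt i : (i < N)%N -> t i < t i.+1.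
  move=> iN; rewrite ltNge; apply/negP.
  have [/andP[t1 _] e] := tP i (ltnW iN).
  have [/andP[t2 _] e'] := tP _ iN.
  by rewrite le_tE ?(ltnW iN)// /u e' ler_nat ltnn.
(* The tolerance [1 / N] lets the [N] errors add up to 1. *)
have [P PP] : exists P : nat -> {poly R}, forall i, (i < N)%N ->
    forall x : R, -1 <= x <= 1 ->
      (x <= t i)%R%:R <= (P i).[x] <= (x <= t i.+1)%R%:R + N%:R^-1.
  suff /choice : forall i, exists p : {poly R}, (i < N)%N -> forall x : R,
      -1 <= x <= 1 -> (x <= t i)%R%:R <= p.[x] <= (x <= t i.+1)%R%:R + N%:R^-1.
    by case=> P PP; exists P.
  move=> i; have [iN|_] := ltnP i N; last by exists 0.
  have [p hp] := @step_poly R (t i) (t i.+1) N%:R^-1 (tlt i iN) ltac:(by rewrite invr_gt0).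
  exists p => _ x x1; have /andP[-> /le_trans->//] := hp x x1.
  by rewrite lerD2r ler_nat; case: ltP => // /ltW ->.
pose S (x : R) := \sum_(i < N) (x <= t i)%R%:R : R.
have hS (x : R) : -1 <= x <= 1 ->
    N%:R * (1 - u x ^+ j) - 1 <= S x <= N%:R * (1 - u x ^+ j).
  move=> /andP[x1 x2].
  have -> : S x = \sum_(i < N) (N%:R * u x ^+ j <= i%:R)%R%:R.
    by apply: eq_bigr => i _; rewrite le_tE// ltnW.
  rewrite mulrBr mulr1; apply: sum_ge_indic.
  rewrite mulr_ge0 ?exprn_ge0//=; last by rewrite /u; lra.
  by rewrite ler_piMr// exprn_ile1// /u; lra.
(* One unit of the 2 comes from the tolerances, the other from moving every indicator up by one
   layer. *)
have sumP x : -1 <= x <= 1 -> S x <= (\sum_(i < N) P i).[x] <= S x + 2.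
  move=> x1; rewrite horner_sum; apply/andP; split.
    by apply: ler_sum => i _; have /andP[] := PP i (ltn_ord i) x x1.
  apply: (@le_trans _ _ (\sum_(i < N) ((x <= t i.+1)%R%:R + N%:R^-1))).
    by apply: ler_sum => i _; have /andP[] := PP i (ltn_ord i) x x1.
  rewrite big_split/= sumr_const card_ord -[N%:R^-1 *+ N]mulr_natr mulVf ?gt_eqF//.
  have := @sum_shift (fun i => (x <= t i)%R%:R) N; rewrite -/(S x).
  have : 0 <= (x <= t 0%N)%R%:R :> R by [].
  have : (x <= t N)%R%:R <= 1 :> R by case: (x <= t N).
  lra.
have L1 : 0 <= L 1.
  by apply: (distribution_function_ge0 _ _ _ LF) => x _; rewrite hornerC.
have FN : F (t N) <= L 1.
  apply: lo => x /andP[x1 x2]; rewrite hornerC; by case: (x <= t N).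
have F0 : 0 <= F (t 0%N) by exact: distribution_function_nneg _ _ _ LF.
have LP : L (\sum_(i < N) P i) = \sum_(i < N) L (P i) by rewrite linear_sum.
have hq : L (N%:R *: (1 - unit_map ^+ j)) = N%:R * L (1 - unit_map ^+ j).
  by rewrite scalarZ.
have qE x : (N%:R *: (1 - unit_map ^+ j)).[x] = N%:R * (1 - u x ^+ j).
  by rewrite hornerZ hornerD hornerN hornerC horner_exp horner_unit_map.
have up : N%:R * L (1 - unit_map ^+ j) - L 1 <= \sum_(i < N) L (P i).
  rewrite -hq -LP -linearB; apply: (distribution_function_le _ _ _ _ LF) => x x1.
  rewrite hornerD hornerN hornerC qE.
  by have /andP[h1 _] := hS x x1; have /andP[h2 _] := sumP x x1; lra.
have dn : \sum_(i < N) L (P i) <= N%:R * L (1 - unit_map ^+ j) + 2 * L 1.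
  rewrite -hq -LP -[2 * _]scalarZ -linearD.
  apply: (distribution_function_le _ _ _ _ LF) => x x1.
  rewrite hornerD qE hornerZ hornerC mulr1.
  by have /andP[_ h1] := hS x x1; have /andP[_ h2] := sumP x x1; lra.
have Fdn : \sum_(i < N) F (t i) <= \sum_(i < N) L (P i).
  by apply: ler_sum => i _; apply: lo => x x1; have /andP[] := PP i (ltn_ord i) x x1.
have Fup : \sum_(i < N) L (P i) <= \sum_(i < N) F (t i.+1) + L 1.
  have -> : L 1 = \sum_(i < N) N%:R^-1 * L 1.
    by rewrite -mulr_suml sumr_const card_ord -[N%:R^-1 *+ N]mulr_natr mulVf ?gt_eqF ?mul1r.
  rewrite -big_split; apply: ler_sum => i _; apply: hi => x x1.
  by have /andP[] := PP i (ltn_ord i) x x1.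
(* Going from [t i.+1] back to [t i] costs at most [F (t N) <= L 1]; with the losses in [Fup] and
   [up] this makes the constant 3. *)
have := @sum_shift (fun i => F (t i)) N.
rewrite ler_norml; lra.
Qed.

(** Intermediate values of [N u ^ j], which grows from 0 at [-1] to [N] at 1. *)
Lemma unit_map_layers j N : (0 < N)%N -> (0 < j)%N ->
  exists t : nat -> R, forall i, (i <= N)%N ->
    -1 <= t i <= 1 /\ N%:R * ((1 + t i) / 2) ^+ j = i%:R.
Proof.
move=> N0 j0.
suff /choice : forall i, exists t : R, (i <= N)%N ->
  -1 <= t <= 1 /\ N%:R * ((1 + t) / 2) ^+ j = i%:R.
  by case=> t tP; exists t.
move=> i; have [iN|_] := leqP i N; last by exists 0.
have pE x : (N%:R *: unit_map ^+ j - i%:R%:P).[x] = N%:R * ((1 + x) / 2) ^+ j - i%:R.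
  by rewrite hornerD hornerN hornerZ hornerC horner_exp horner_unit_map.
have [||t t1 /rootP] := @poly_ivt _ (N%:R *: unit_map ^+ j - i%:R%:P) (-1) 1.
- lra.
- rewrite !pE subrr mul0r expr0n gtn_eqF// mulr0 sub0r oppr_le0 ler0n/=.
  by rewrite divff ?pnatr_eq0// expr1n mulr1 subr_ge0 ler_nat.
by rewrite pE => /eqP; rewrite subr_eq0 => /eqP ?; exists t.
Qed.

(** The layer sums depend on [F] only, so [N] times the difference of the two functionals at
    [1 - unit_map ^ j] is at most [(3 + 3) L 1] for every [N > 0]. *)
Lemma distribution_function_inj (L M : {scalar {poly R}}) F :
  distribution_function L F -> distribution_function M F -> L =1 M.
Proof.
move=> LF MF.
have LM1 : L 1 = M 1.
  by rewrite -(distribution_function1 _ _ 1 LF)// (distribution_function1 _ _ 1 MF).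
have LMu j : L (unit_map ^+ j) = M (unit_map ^+ j).
  have [->|j0] := posnP j; first by rewrite !expr0.
  suff : L (1 - unit_map ^+ j) = M (1 - unit_map ^+ j).
    by rewrite !linearB/= LM1; lra.
  set q := 1 - _.
  have bound m : `|m.+1%:R * (L q - M q)| <= 6 * L 1.
    have [t tP] := @unit_map_layers j m.+1 isT j0.
    have := distribution_function_layers _ _ _ m.+1 _ LF isT j0 tP.
    have := distribution_function_layers _ _ _ m.+1 _ MF isT j0 tP.
    by rewrite -/q -LM1 !ler_norml; lra.
  apply/eqP; rewrite eq_le -subr_ge0 -[X in _ && X]subr_ge0; apply/andP; split.
    apply: (@ge0_of_inv_bound _ _ (6 * L 1)) => m.
    rewrite lerNl ler_pdivlMr ?ltr0n//.
    by have := bound m; rewrite ler_norml; lra.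
  apply: (@ge0_of_inv_bound _ _ (6 * L 1)) => m.
  rewrite lerNl ler_pdivlMr ?ltr0n//.
  by have := bound m; rewrite ler_norml; lra.
(* Every polynomial is a polynomial in [unit_map], whose compositional inverse is [2 'X - 1]. *)
move=> p; have -> : p = (p \Po (2%:P * 'X - 1)) \Po unit_map.
  rewrite -comp_polyA -[p in LHS]comp_polyXr; congr (_ \Po _).
  rewrite comp_polyB comp_polyM comp_polyC comp_polyX.
  by rewrite mul_polyC scalerA mulfV// scale1r comp_polyC; ring.
move: (p \Po _) => {}p; rewrite comp_polyE !linear_sum.
by apply: eq_bigr => i _; rewrite !scalarZ LMu.
Qed.

End DistributionFunction.

(** * Integrals against a finite measure vanishing off a set [K] *)

Section ConcentratedMeasure.
Variable R : realType.
Variable nu : {finite_measure set (measurableTypeR R) -> \bar R}.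
Variable K : set (measurableTypeR R).
Hypothesis mK : measurable K.
Hypothesis nuK : nu (~` K) = 0%E.
Implicit Types f g : measurableTypeR R -> R.

Lemma integrable_concentrated (f : measurableTypeR R -> R) (C : R) :
  measurable_fun setT f -> (forall x, K x -> `|f x| <= C) ->
  nu.-integrable setT (EFin \o f).
Proof.
move=> mf fC; apply/(@negligible_integrable _ _ _ _ _ (~` K)) => //.
- exact: measurableC.
- exact/measurable_EFinP.
rewrite setTD setCK; apply: measurable_bounded_integrable => //.
- by rewrite ltey_eq fin_num_measure.
- exact: measurable_funTS.
exists C; split; first exact: num_real.
by move=> M CM x Kx; exact: le_trans (fC x Kx) (ltW CM).
Qed.

Lemma Rintegral_concentrated f : nu.-integrable setT (EFin \o f) ->
  \int[nu]_x f x = \int[nu]_(x in K) f x.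
Proof.
move=> fi; rewrite /Rintegral (@negligible_integral _ _ _ _ _ (~` K))//.
  by rewrite setTD setCK.
exact: measurableC.
Qed.

Lemma le_Rintegral_concentrated f g :
  nu.-integrable setT (EFin \o f) -> nu.-integrable setT (EFin \o g) ->
  (forall x, K x -> f x <= g x) -> \int[nu]_x f x <= \int[nu]_x g x.
Proof.
move=> fi gi fg; rewrite !Rintegral_concentrated//; apply: le_Rintegral => //.
- exact: integrableS fi.
- exact: integrableS gi.
Qed.

End ConcentratedMeasure.

(** * Integrals of polynomials against compactly supported measures *)

Section PolynomialIntegral.
Variable R : realType.
Implicit Type nu : {finite_measure set (measurableTypeR R) -> \bar R}.
Implicit Type p : {poly R}.

Lemma measurable_horner p : measurable_fun setT (horner p : measurableTypeR R -> R).
Proof. apply: continuous_measurable_fun; exact: continuous_horner. Qed.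

Lemma integrable_horner nu p : compactly_supported nu ->
  nu.-integrable setT (EFin \o horner p).
Proof.
move=> [K cK nuK].
have mK : measurable (K : set (measurableTypeR R)).
  by apply: closed_measurable; apply: compact_closed => //; exact: norm_hausdorff.
have [C [_ hC]] : [bounded p.[x] | x in K].
  have := @continuous_compact _ _ (horner p) K.
  move=> /(_ (continuous_subspaceT (@continuous_horner _ p)) cK).
  move=> /compact_bounded[C [Cr hC]]; exists C; split => // M CM x Kx.
  by apply: hC CM _ _; exists x.
apply: (@integrable_concentrated _ _ K mK nuK _ (C + 1)).
  exact: measurable_horner.
by move=> x Kx; apply: hC => //; rewrite ltrDl.
Qed.

Definition poly_integral nu p : R := \int[nu]_x p.[x].

Lemma poly_integral_is_scalar nu : compactly_supported nu ->
  scalar (poly_integral nu).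
Proof.
move=> nuK a p q; rewrite /poly_integral.
under eq_Rintegral do rewrite hornerD hornerZ.
rewrite RintegralD//; last exact: integrable_horner.
  by rewrite RintegralZl//; exact: integrable_horner.
have := integrable_horner _ (a *: p) nuK; congr integrable.
by apply/funext => x /=; rewrite hornerZ.
Qed.

(** Linearity rests on the integrability of polynomials, so the bundled functional carries a proof
    of compact support. *)
Definition poly_integral_scalar nu (cnu : compactly_supported nu) :
    {scalar {poly R}} :=
  HB.pack (poly_integral nu) (GRing.isLinear.Build R {poly R} R *%R _
    (poly_integral_is_scalar nu cnu)).

Lemma compactly_supported_itv nu :
  nu (~` `[(-1 : R), 1]) = 0%E -> compactly_supported nu.
Proof. by exists `[-1, 1]%classic => //; exact: segment_compact. Qed.

Lemma measurable_indic_le (t : R) :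
  measurable_fun setT (fun x : measurableTypeR R => (x <= t)%R%:R : R).
Proof.
rewrite (_ : (fun x => _) = \1_(`]-oo, t]%classic)) //.
apply/funext => x; rewrite indicE; congr (_%:R).
by rewrite mem_setE in_itv.
Qed.

Lemma Rintegral_indic_le nu (t : R) :
  \int[nu]_x (x <= t)%R%:R = fine (nu `]-oo, t]%classic).
Proof.
rewrite (_ : (fun x => _) = \1_(`]-oo, t]%classic)); last first.
  by apply/funext => x; rewrite indicE mem_setE in_itv.
by rewrite /Rintegral integral_indic// setIT.
Qed.

Lemma poly_integral1 nu : poly_integral nu 1 = fine (nu setT).
Proof.
rewrite /poly_integral; under eq_Rintegral do rewrite hornerC.
by rewrite Rintegral_cst// mul1r.
Qed.

(** Both bounds are monotonicity of the integral, the measure of a half-line being the integral of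
    its indicator. *)
Lemma distribution_function_measure nu : nu (~` `[(-1 : R), 1]) = 0%E ->
  distribution_function _ (poly_integral nu) (fun t => fine (nu `]-oo, t]%classic)).
Proof.
move=> nu1; have cnu := compactly_supported_itv _ nu1.
have mI : measurable (`[(-1 : R), 1]%classic : set (measurableTypeR R)).
  exact: measurable_itv.
have ind t : nu.-integrable setT (EFin \o (fun x : measurableTypeR R => (x <= t)%R%:R : R)).
  apply: (@integrable_concentrated _ _ _ mI nu1 _ 1).
    exact: measurable_indic_le.
  by move=> x _; rewrite ger0_norm; case: (x <= t).
have inp p := integrable_horner nu p cnu.
split=> [t p tp|t e p tp].
  rewrite -Rintegral_indic_le; apply: (le_Rintegral_concentrated _ _ _ mI nu1) => //.
rewrite -Rintegral_indic_le poly_integral1 -[e * _](Rintegral_cst nu)//.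
have ie : nu.-integrable setT (EFin \o (cst e : measurableTypeR R -> R)).
  by apply: (@integrable_concentrated _ _ _ mI nu1 _ `|e|) => //.
rewrite -(RintegralD measurableT (ind t) ie); apply: (le_Rintegral_concentrated _ _ _ mI nu1) => //.
  have := integrableD measurableT (ind t) ie; exact.
Qed.

End PolynomialIntegral.

(** * The Hausdorff moment problem on [[-1, 1]]: existence and uniqueness *)

Section HausdorffMoment.
Variable R : realType.

Section DistributionOfFunctional.
Variable L : {scalar {poly R}}.
Hypothesis L0 :
  forall p : {poly R}, (forall x : R, -1 <= x <= 1 -> 0 <= p.[x]) -> 0 <= L p.

Definition majorants (t : R) : set R :=
  [set L p | p in [set p : {poly R} |
     forall x : R, -1 <= x <= 1 -> (x <= t)%R%:R <= p.[x]]].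

Definition inf_distribution (t : R) : R := inf (majorants t).

Let F := inf_distribution.

Let L_le (p q : {poly R}) :
  (forall x : R, -1 <= x <= 1 -> p.[x] <= q.[x]) -> L p <= L q.
Proof.
move=> pq; rewrite -subr_ge0 -linearB; apply: L0 => x x1.
by rewrite hornerD hornerN subr_ge0 pq.
Qed.

Let majorants_ge0 t : lbound (majorants t) 0.
Proof. by move=> _ [p tp <-]; apply: L0 => x /tp; apply: le_trans. Qed.

Let majorants_nonempty t : majorants t !=set0.
Proof.
by exists (L 1); exists 1 => // x _; rewrite hornerC; case: (x <= t).
Qed.

Lemma inf_distribution_lo t (p : {poly R}) :
  (forall x : R, -1 <= x <= 1 -> (x <= t)%R%:R <= p.[x]) -> F t <= L p.
Proof.
move=> tp; apply: ge_inf; first by exists 0; exact: majorants_ge0.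
by exists p.
Qed.

(** For the upper bound, [p] lies below [q + e] for every majorant [q]; the infimum is then taken
    over [q]. *)
Lemma inf_distributionP : distribution_function _ L F.
Proof.
split=> [t p|t e p tp]; first exact: inf_distribution_lo.
rewrite -lerBlDr; apply: lb_le_inf => // _ [q tq <-].
rewrite lerBlDr -scalarZ -linearD; apply: L_le => x x1.
by rewrite hornerD hornerZ hornerC mulr1 (le_trans (tp x x1))// lerD2r tq.
Qed.

Lemma inf_distribution_nondecreasing : nondecreasing F.
Proof.
move=> s t st; apply: lb_le_inf => // _ [p tp <-]; apply: inf_distribution_lo.
move=> x /tp; apply: le_trans; rewrite ler_nat.
by case: (leP x s) => // /le_trans -> .
Qed.

Lemma inf_distributionNy t : t < -1 -> F t = 0.
Proof.
move=> t1; apply/eqP; rewrite eq_le (distribution_function_nneg _ _ _ t inf_distributionP) andbT.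
rewrite -[leRHS](linear0 L); apply: inf_distribution_lo => x /andP[x1 _].
by rewrite horner0 [x <= t]leNgt (lt_le_trans t1 x1).
Qed.

(** A nearly optimal majorant at [t], raised by a small constant [h], still majorizes the indicator
    at every [u] slightly to the right of [t]. *)
Lemma inf_distribution_right_continuous : right_continuous F.
Proof.
move=> t; apply/cvgrPdist_le => e e0.
have L1 : 0 <= L 1 by apply: L0 => x _; rewrite hornerC.
have [p tp pF] : exists2 p : {poly R},
    forall x : R, -1 <= x <= 1 -> (x <= t)%R%:R <= p.[x] & L p < F t + e / 2.
  have [||_ [p tp <-] pF] := @inf_adherent _ (majorants t) (e / 2).
  - by rewrite divr_gt0.
  - by split => //; exists 0; exact: majorants_ge0.
  by exists p.
(* Raising by [h] costs [h * L 1 <= e / 2]; the added 1 covers the case [L 1 = 0]. *)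
pose h := e / 2 / (L 1 + 1).
have h0 : 0 < h by rewrite !divr_gt0// ltr_wpDl.
suff near_le : \forall u \near t^'+,
    forall x : R, -1 <= x <= 1 -> (x <= u)%R%:R <= p.[x] + h.
  near=> u.
  have tu : t <= u by near: u; exact: nbhs_right_ge.
  rewrite distrC ger0_norm; last first.
    by rewrite subr_ge0; exact: inf_distribution_nondecreasing.
  have : F u <= L (p + h *: 1).
    apply: inf_distribution_lo => x x1.
    by rewrite hornerD hornerZ hornerC mulr1; move: x x1; near: u.
  rewrite linearD scalarZ.
  have : h * L 1 <= e / 2.
    rewrite /h mulrAC ler_pdivrMr ?ltr_wpDl// ler_wpM2l ?lerDl//; lra.
  lra.
have far x u : -1 <= x <= 1 -> (x <= u) = (x <= t) ->
    (x <= u)%R%:R <= p.[x] + h.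
  by move=> x1 ->; rewrite (le_trans (tp x x1))// lerDl ltW.
have [t1|t1] := ltP t (-1).
  near=> u => x x1; apply: far => //.
  have u1 : u < -1 by near: u; exact: nbhs_right_lt.
  have /andP[x1' _] := x1.
  by rewrite [x <= u]leNgt (lt_le_trans u1 x1') [x <= t]leNgt (lt_le_trans t1 x1').
have [t2|t2] := ltP 1 t.
  near=> u => x x1; apply: far => //.
  have tu : t <= u by near: u; exact: nbhs_right_ge.
  have /andP[_ x1'] := x1; have xt := le_trans x1' (ltW t2).
  by rewrite xt (le_trans xt tu).
(* The indicator changes only on []t, u]], where continuity keeps [p] above [1 - h]. *)
have pt : 1 <= p.[t] by have := tp t; rewrite t1 t2 lexx => /(_ isT).
have : {for t, continuous (horner p)} by exact: continuous_horner.
move=> /cvgrPdist_lt /(_ _ h0) /nbhs_ballP[d /= d0 hd].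
near=> u => x x1; have [xt|tx] := leP x t.
  have tu : t <= u by near: u; exact: nbhs_right_ge.
  by apply: far => //; rewrite xt (le_trans xt tu).
have [xu|ux] := leP x u; last first.
  by apply: addr_ge0; [apply: le_trans (tp x x1)|exact: ltW].
have ud : u < t + d by near: u; apply: nbhs_right_lt; rewrite ltrDl.
have : `|p.[t] - p.[x]| < h.
  apply: hd; rewrite /ball/= ltr_norml; apply/andP; lra.
by rewrite ltr_norml /=; lra.
Unshelve. all: by end_near. Qed.

HB.instance Definition _ := isCumulative.Build R _ R inf_distribution
  inf_distribution_nondecreasing inf_distribution_right_continuous.

(** The Lebesgue-Stieltjes measure of [F] has [F] as its distribution function, and a functional is
    determined by its distribution function. *)
Lemma exists_measure_of_functional :
  exists2 nu : {finite_measure set (measurableTypeR R) -> \bar R},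
    nu (~` `[(-1 : R), 1]) = 0%E & forall p, L p = poly_integral _ nu p.
Proof.
pose mu := lebesgue_stieltjes_measure F.
have muE a b : a <= b -> mu `]a, b]%classic = (F b - F a)%:E.
  move=> ab; rewrite /mu /lebesgue_stieltjes_measure /measure_extension.
  by rewrite measurable_mu_extE/= ?wlength_itv_bnd//; exact: is_ocitv.
(* The restriction makes the measure finite; the left end [-2] keeps a possible atom at [-1]. *)
pose D : set (measurableTypeR R) := `](-2), 1]%classic.
have mD : measurable D by exact: measurable_itv.
have muD : (mu D < +oo)%E by rewrite muE ?ltry//; lra.
pose nu : {finite_measure set (measurableTypeR R) -> \bar R} := mfrestr mD muD.
have nuE A : nu A = mu (A `&` D) by [].
have F2 : F (-2) = 0 by apply: inf_distributionNy; lra.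
have nu1 : nu (~` `[(-1 : R), 1]%classic) = 0%E.
  (* What remains is []-2, -1[], a countable union of half-open intervals at both ends of which [F]
     is 0. *)
  rewrite nuE (_ : _ `&` _ = \bigcup_n `](-2 : R), -1 - n.+1%:R^-1]%classic); last first.
    rewrite -itv_bnd_open_bigcup /D; apply/seteqP; split => x /=; rewrite !in_itv/=.
      by move=> [/negP + /andP[x2 x1]]; rewrite x1 andbT x2 -ltNge.
    move=> /andP[x2 x1]; split; last by rewrite x2; lra.
    by apply/negP; rewrite negb_and -ltNge x1.
  apply/negligibleP; first by apply: bigcup_measurable => n _; exact: measurable_itv.
  apply: negligible_bigcup => n; apply/negligibleP; first exact: measurable_itv.
  have n0 : 0 < n.+1%:R^-1 :> R by rewrite invr_gt0.
  have n1 : n.+1%:R^-1 <= 1 :> R by rewrite invf_le1 ?ler1n.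
  move: n.+1%:R^-1 n0 n1 => h h0 h1.
  apply: (eq_trans (muE _ _ _)); first lra.
  by rewrite F2 inf_distributionNy ?subrr//; lra.
have cnu := compactly_supported_itv _ _ nu1.
exists nu => //.
pose M := poly_integral_scalar _ _ cnu.
suff MF : distribution_function _ M F.
  by move=> p; exact: (distribution_function_inj _ _ M _ inf_distributionP MF).
suff <- : (fun t => fine (nu `]-oo, t]%classic)) = F.
  exact: distribution_function_measure.
apply/funext => t; rewrite nuE.
have -> : `]-oo, t]%classic `&` D = `](-2), (Num.min t 1)]%classic.
  rewrite /D; apply/seteqP; split => x /=; rewrite !in_itv/= le_min.
    by move=> [-> /andP[-> ->]].
  by move=> /andP[-> /andP[-> ->]].
have [t2|t2] := leP (-2) t.
  rewrite muE; last by rewrite le_min t2; lra.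
  rewrite F2 subr0/=; case: leP => // t1.
  by rewrite !(distribution_function1 _ _ _ _ inf_distributionP)// ltW.
rewrite set_itv_ge; last by rewrite bnd_simp -leNgt ge_min ltW.
by rewrite /mu measure0 inf_distributionNy//; lra.
Qed.

End DistributionOfFunctional.

(** Equal moments give equal functionals. Step polynomials bound the measure of one half-line by the
    other measure of a slightly longer one, continuity from above removes the excess, and the
    intervals []a, b]] determine the measure. *)
Lemma measure_eq_of_moments (nu nu' : {finite_measure set (measurableTypeR R) -> \bar R}) :
  nu (~` `[(-1 : R), 1]%classic) = 0%E -> nu' (~` `[(-1 : R), 1]%classic) = 0%E ->
  (forall n : nat, \int[nu]_x (x ^+ n) = \int[nu']_x (x ^+ n)) ->
  forall A, measurable A -> nu A = nu' A.
Proof.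
move=> nu1 nu1' eq_mom.
have cnu := compactly_supported_itv _ _ nu1.
have cnu' := compactly_supported_itv _ _ nu1'.
pose M := poly_integral_scalar _ _ cnu.
pose M' := poly_integral_scalar _ _ cnu'.
have MM' p : M p = M' p.
  rewrite (scalar_polyE _ M) (scalar_polyE _ M'); apply: eq_bigr => i _; congr (_ * _).
  rewrite /= /poly_integral; under eq_Rintegral do rewrite hornerXn.
  by rewrite eq_mom; under [RHS]eq_Rintegral do rewrite hornerXn.
have nuF (m : {finite_measure set (measurableTypeR R) -> \bar R}) A :
    measurable A -> m A = (fine (m A))%:E.
  by move=> mA; rewrite fineK// fin_num_measure.
(* Quantifying over measures and functionals allows use in both directions. *)
suff le_cdf (m m' : {finite_measure set (measurableTypeR R) -> \bar R})
    (N N' : {scalar {poly R}}) : N =1 N' -> 0 <= N' 1 ->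
    distribution_function _ N (fun t => fine (m `]-oo, t]%classic)) ->
    distribution_function _ N' (fun t => fine (m' `]-oo, t]%classic)) ->
    forall t : R, fine (m `]-oo, t]%classic) <= fine (m' `]-oo, t]%classic).
  have cdf t : nu `]-oo, t]%classic = nu' `]-oo, t]%classic.
    rewrite [LHS]nuF// [RHS]nuF//; congr EFin; apply/eqP.
    have d := distribution_function_measure _ _ nu1.
    have d' := distribution_function_measure _ _ nu1'.
    have M0 : 0 <= M 1 by apply: Rintegral_ge0 => x _; rewrite hornerC.
    have M'0 : 0 <= M' 1 by apply: Rintegral_ge0 => x _; rewrite hornerC.
    rewrite eq_le (le_cdf _ _ M M' MM' M'0 d d').
    by rewrite (le_cdf _ _ M' M _ M0 d' d).
  apply: (@measure_unique _ _ (measurableTypeR R) (@ocitv R)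
    (fun n => `](- n%:R), n%:R]%classic)) => //.
  - exact: ocitvI.
  - by move=> n; exact: is_ocitv.
  - exact: (bigcup_itvT false false).
  - move=> _ [[a b] _ <-] /=.
    have [ab|ba] := leP a b; last first.
      by rewrite set_itv_ge ?measure0// bnd_simp -leNgt ltW.
    have -> : `]a, b]%classic = `]-oo, b]%classic `\` `]-oo, a]%classic.
      apply/seteqP; split => x /=; rewrite !in_itv/=.
        by move=> /andP[ax ->]; split => //; apply/negP; rewrite -ltNge.
      by move=> [-> /negP]; rewrite -ltNge => ->.
    have ab' : `]-oo, b]%classic `&` `]-oo, a]%classic = `]-oo, a]%classic :> set R.
      apply/setIidr => x /=; rewrite !in_itv/= => /le_trans; exact.
    rewrite !measureD ?ab'//; first by congr (_ - _)%E; exact: cdf.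
      by rewrite ltey_eq fin_num_measure.
    by rewrite ltey_eq fin_num_measure.
  - by move=> n; rewrite ltey_eq fin_num_measure.
move=> NN' N1 [lo _] [_ hi'] t.
have le_shift n :
    (m `]-oo, t]%classic <= m' `]-oo, (t + n.+1%:R^-1)%R]%classic)%E.
  rewrite [leLHS]nuF// [leRHS]nuF// lee_fin; apply/ler_addgt0Pr => e e0.
  have h0 : 0 < e / (N' 1 + 1) by rewrite divr_gt0// ltr_wpDl.
  have tn : t < t + n.+1%:R^-1 by rewrite ltrDl.
  have [p hp] := step_poly _ _ _ _ tn h0.
  have h1 : fine (m `]-oo, t]%classic) <= N p.
    by apply: lo => x x1; have /andP[] := hp x x1.
  have h2 : N' p <= fine (m' `]-oo, t + n.+1%:R^-1]%classic) + e / (N' 1 + 1) * N' 1.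
    apply: hi' => x x1; have /andP[_ /le_trans] := hp x x1; apply.
    by rewrite lerD2r ler_nat; case: ltP => // /ltW ->.
  have : e / (N' 1 + 1) * N' 1 <= e.
    by rewrite mulrAC ler_pdivrMr ?ltr_wpDl// ler_wpM2l ?lerDl// ltW.
  by rewrite NN' in h1; lra.
have cvg_shift : m' `]-oo, t + n.+1%:R^-1]%classic @[n --> \oo] --> m' `]-oo, t]%classic.
  rewrite (itvNycEbigcap false); apply: nonincreasing_cvg_mu => [|n||n k nk].
  - by rewrite ltey_eq fin_num_measure.
  - exact: measurable_itv.
  - by apply: bigcap_measurable => // n _; exact: measurable_itv.
  - apply/subsetPset; apply: subset_itvl.
    by rewrite bnd_simp lerD2l lef_pV2 ?posrE// ler_nat.
rewrite -lee_fin -!nuF//; apply: (cvge_to_ge cvg_shift).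
exact: nearW.
Qed.

End HausdorffMoment.

(** * Representing triplets *)

Section QPolynomial.
Variable R : realType.
Implicit Types (x : R) (n : nat).

Definition q_poly n : {poly R} := \sum_(j < n.-1) (n - j - 1)%:R *: 'X^j.

Lemma horner_q_poly n x : (q_poly n).[x] = Q n x.
Proof. by rewrite horner_sum; apply: eq_bigr => j _; rewrite hornerZ hornerXn. Qed.

(** Makes the first difference of [Q] a geometric sum and its second difference a monomial. *)
Lemma q_polyS n : q_poly n.+1 = q_poly n + \sum_(j < n) 'X^j.
Proof.
(* The extra term [j = n - 1] has coefficient 0. *)
have -> : q_poly n = \sum_(j < n) (n - j - 1)%:R *: 'X^j.
  case: n => [|n]; first by rewrite /q_poly !big_ord0.
  by rewrite [RHS]big_ord_recr/= subSnn subnn scale0r addr0.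
rewrite -big_split; apply: eq_bigr => j _ /=.
rewrite (_ : (n.+1 - j - 1 = (n - j - 1).+1)%N); last by have := ltn_ord j; lia.
by rewrite -natr1 scalerDl scale1r.
Qed.

Lemma geometric_sumE n x : x != 1 ->
  (\sum_(j < n) 'X^j : {poly R}).[x] = (1 - x ^+ n) / (1 - x).
Proof.
move=> x1; have x1' : 1 - x != 0 by rewrite subr_eq0 eq_sym.
apply: (mulIf x1'); rewrite divfK// horner_sum -[RHS]opprB subrX1.
under eq_bigr do rewrite hornerXn.
by ring.
Qed.

Lemma Q_closed_form n x : x != 1 ->
  (1 - x ^+ n) / (1 - x) ^+ 2 = n%:R / (1 - x) - Q n x.
Proof.
move=> x1; have x1' : 1 - x != 0 by rewrite subr_eq0 eq_sym.
rewrite -horner_q_poly; elim: n => [|n IH].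
  by rewrite expr0 subrr mul0r /q_poly big_ord0 horner0 mul0r subrr.
rewrite q_polyS hornerD opprD addrA -natr1 [(_ + 1) * _]mulrDl mul1r geometric_sumE//.
rewrite [x ^+ _]exprS; have -> : (1 - x * x ^+ n) / (1 - x) ^+ 2 =
  (1 - x ^+ n) / (1 - x) ^+ 2 + x ^+ n / (1 - x) by field.
by rewrite IH; field.
Qed.

End QPolynomial.

Section RepresentingTriplet.
Variable R : realType.
Implicit Types (nu : {finite_measure set (measurableTypeR R) -> \bar R}).
Implicit Types (gamma : R^nat) (b c : R).

Lemma poly_integral_sum_Xn nu n : compactly_supported nu ->
  poly_integral _ nu (\sum_(j < n) 'X^j) = \sum_(j < n) poly_integral _ nu 'X^j.
Proof.
move=> cnu.
pose M := poly_integral_scalar _ _ cnu.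
exact: (linear_sum M).
Qed.

Lemma representing_triplet_telescope gamma b c nu n :
  representing_triplet gamma b c nu ->
  telescope gamma n =
    b + c * (2 * n%:R + 1) + poly_integral _ nu (\sum_(j < n) 'X^j).
Proof.
move=> [_ cnu _ gE]; rewrite /telescope/= (gE n.+1) (gE n).
have QE m : \int[nu]_x Q m x = poly_integral _ nu (q_poly R m).
  by rewrite /poly_integral; under [RHS]eq_Rintegral do rewrite horner_q_poly.
have := poly_integral_is_scalar _ _ cnu 1 (q_poly R n) (\sum_(j < n) 'X^j).
by rewrite scale1r -q_polyS !QE => ->; rewrite -natr1; ring.
Qed.

Lemma representing_triplet_second_diff gamma b c nu n :
  representing_triplet gamma b c nu ->
  second_diff _ gamma n = 2 * c + poly_integral _ nu 'X^n.
Proof.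
move=> T; have [_ cnu _ _] := T.
have -> : second_diff _ gamma n = telescope gamma n.+1 - telescope gamma n.
  by rewrite /second_diff /telescope/=; ring.
rewrite !(representing_triplet_telescope _ _ _ _ _ T) !poly_integral_sum_Xn//.
by rewrite big_ord_recr/= -natr1; ring.
Qed.

Lemma second_diff_cvg0 gamma :
  cvgn (telescope gamma) -> second_diff _ gamma @ \oo --> 0.
Proof.
move=> cg; rewrite (_ : second_diff _ gamma =
  fun n => telescope gamma n.+1 - telescope gamma n); last first.
  by apply/funext => n; rewrite /second_diff /telescope/=; ring.
rewrite -(subrr (limn (telescope gamma))); apply: cvgB => //.
by rewrite cvg_shiftS.
Qed.

(** The second differences are summed twice: to the first differences, starting from
    [gamma 1 - gamma 0], and then to [gamma]. *)
Lemma representing_triplet_of_moments gamma nu :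
  compactly_supported nu -> nu [set 1] = 0%E ->
  (forall n, second_diff _ gamma n = poly_integral _ nu 'X^n) ->
  representing_triplet gamma (gamma 1%N - gamma 0%N) 0 nu.
Proof.
move=> cnu nu1 mom; split => // n.
have tE m : telescope gamma m =
    gamma 1%N - gamma 0%N + poly_integral _ nu (\sum_(j < m) 'X^j).
  rewrite poly_integral_sum_Xn//; elim: m => [|m IH].
    by rewrite big_ord0 addr0.
  rewrite big_ord_recr/= addrA -IH -mom /second_diff /telescope/=; ring.
have QE m : \int[nu]_x Q m x = poly_integral _ nu (q_poly R m).
  by rewrite /poly_integral; under [RHS]eq_Rintegral do rewrite horner_q_poly.
rewrite QE mul0r addr0; elim: n => [|n IH].
  have -> : q_poly R 0 = 0 by rewrite /q_poly big_ord0.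
  rewrite mulr0 addr0 /poly_integral.
  by under eq_Rintegral do rewrite horner0; rewrite Rintegral_cst// mul0r addr0.
have -> : gamma n.+1 = gamma n + telescope gamma n by rewrite /telescope/=; ring.
have := poly_integral_is_scalar _ _ cnu 1 (q_poly R n) (\sum_(j < n) 'X^j).
by rewrite scale1r -q_polyS => ->; rewrite tE IH -natr1; ring.
Qed.

(* [x ^ 2n >= 1] off ]-1, 1[, so the even moments dominate the mass there. *)
Lemma concentrated_of_moments_cvg nu c : compactly_supported nu -> 0 <= c ->
  2 * c + poly_integral _ nu 'X^n @[n --> \oo] --> 0 ->
  c = 0 /\ nu (~` `]-1, 1[%classic) = 0%E.
Proof.
move=> cnu c0 mom0; pose A : set (measurableTypeR R) := ~` `]-1, 1[%classic.
have mA : measurable A by apply: measurableC; exact: measurable_itv.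
have iA : nu.-integrable setT (EFin \o (\1_A : measurableTypeR R -> R)).
  apply: (@integrable_concentrated _ _ setT measurableT _ _ 1).
  - by rewrite setCT measure0.
  - exact: measurable_indic.
  by move=> x _; rewrite indicE ger0_norm//; case: (x \in A).
have A_le n : fine (nu A) <= poly_integral _ nu 'X^(n * 2).
  have -> : fine (nu A) = \int[nu]_x (\1_A x).
    by rewrite /Rintegral integral_indic// setIT.
  apply: le_Rintegral => //; first exact: integrable_horner.
  move=> x _; rewrite indicE hornerXn exprM; case: (boolP (x \in A)) => xA.
    move: xA; rewrite inE /A /= in_itv/= => /negP; rewrite negb_and -!leNgt.
    move=> xA; have xn : 1 <= (x ^+ n) ^+ 2.
      by rewrite -exprM mulnC exprM exprn_ege1//; case/orP: xA; nra.
    exact: xn.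
  exact: sqr_ge0.
have A0 : 0 <= fine (nu A) by exact: fine_ge0.
(* At even indices the sequence stays above [2 c + nu A], so the limit 0 forces both nonnegative
   terms to vanish. *)
have le0 : 2 * c + fine (nu A) <= 0.
  rewrite leNgt; apply/negP => e0.
  move/cvgrPdist_lt : mom0 => /(_ _ e0)[N _ /(_ (N * 2)%N)].
  rewrite /= sub0r normrN leq_pmulr// => /(_ isT) /(le_lt_trans (ler_norm _)).
  by rewrite ltrD2l ltNge A_le.
have nA : fine (nu A) = 0 by lra.
split; first lra.
by rewrite -[LHS]fineK ?fin_num_measure// nA.
Qed.

End RepresentingTriplet.

(** * Integrability of [1 / (1 - x)] and the difference formula *)

Section DifferenceRepresentation.
Variable R : realType.
Implicit Types (nu : {finite_measure set (measurableTypeR R) -> \bar R}).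
Implicit Types (gamma : R^nat) (b c d : R).

Let I : set (measurableTypeR R) := `]-1, 1[%classic.

Let mI : measurable I. Proof. exact: measurable_itv. Qed.

Let inI (x : R) : I x -> [/\ -1 < x, x < 1 & x != 1].
Proof. by rewrite /I/= in_itv/= => /andP[-> x1]; rewrite x1 lt_eqF. Qed.

Lemma measurable_inv_1B :
  measurable_fun setT (fun x : measurableTypeR R => (1 - x)^-1 : R).
Proof.
rewrite -(setUv [set (1 : measurableTypeR R)]).
apply/measurable_funU => //; first exact: measurableC.
split; first exact: measurable_fun_set1.
apply: open_continuous_measurable_fun => [|x].
  by apply: closed_openC; apply: accessible_closed_set1; exact: hausdorff_accessible.
rewrite inE /= => /eqP x1; apply: cvgV; first by rewrite subr_eq0 eq_sym.
by apply: cvgB => //; exact: cvg_cst.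
Qed.

Lemma concentrated_closed nu : nu (~` I) = 0%E -> nu (~` `[(-1 : R), 1]%classic) = 0%E.
Proof.
move=> nuI; apply/eqP; rewrite -measure_le0 -nuI le_measure ?inE//.
- by apply: measurableC; exact: measurable_itv.
- exact: measurableC.
- by apply: subsetC => x /=; rewrite !in_itv/= => /andP[/ltW -> /ltW].
Qed.

Lemma geometric_sum_I (x : R) n : I x ->
  (\sum_(j < n) 'X^j : {poly R}).[x] = (1 - x ^+ n) / (1 - x).
Proof. by move=> /inI[_ _ x1]; exact: geometric_sumE. Qed.

Lemma one_sub_expr_cvg (x y : R) : `|y| < 1 ->
  (1 - y ^+ n) / (1 - x) @[n --> \oo] --> (1 - x)^-1.
Proof.
move=> y1; rewrite -[X in _ --> X]mul1r; apply: cvgMr_tmp.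
rewrite -[X in _ --> X]subr0; apply: cvgB; first exact: cvg_cst.
exact: cvg_expr.
Qed.

Lemma integrable_inv_1B nu (B : R) : nu (~` I) = 0%E ->
  (forall n, poly_integral _ nu (\sum_(j < n) 'X^j) <= B) ->
  nu.-integrable setT (fun x : R => ((1 - x)^-1)%:E).
Proof.
move=> nuI SB; have cnu := compactly_supported_itv _ _ (concentrated_closed _ nuI).
(* An even number of terms makes the sums [(1 - x ^ 2n) / (1 - x)] nondecreasing in [n] for negative
   [x] too, as monotone convergence requires. *)
pose s n : {poly R} := \sum_(j < n * 2) 'X^j.
pose f n (x : measurableTypeR R) : \bar R := ((s n).[x])%:E.
have mf n : measurable_fun I (f n).
  by apply/measurable_EFinP; apply: measurable_funTS; exact: measurable_horner.
have sE n x : I x -> (s n).[x] = (1 - (x ^+ 2) ^+ n) / (1 - x).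
  by move=> Ix; rewrite geometric_sum_I// mulnC exprM.
have x2 x : I x -> 0 <= x ^+ 2 <= 1.
  by move=> /inI[? ? _]; rewrite sqr_ge0; nra.
have f0 n x : I x -> (0 <= f n x)%E.
  move=> Ix; rewrite lee_fin sE//; have /andP[? ?] := x2 x Ix.
  have [_ x1 _] := inI _ Ix; apply: divr_ge0; rewrite subr_ge0.
    exact: exprn_ile1.
  exact: ltW.
have ndf x : I x -> {homo f^~ x : n m / (n <= m)%N >-> (n <= m)%E}.
  move=> Ix n m nm; rewrite lee_fin !sE//; have /andP[? ?] := x2 x Ix.
  have [_ x1 _] := inI _ Ix; apply: ler_wpM2r; first by rewrite invr_ge0 subr_ge0 ltW.
  by rewrite lerD2l lerN2 ler_wiXn2l.
have lim_f x : I x -> limn (f^~ x) = ((1 - x)^-1)%:E.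
  move=> Ix; apply/cvg_lim => //; apply/cvg_EFin; first exact: nearW.
  have [? ? _] := inI _ Ix; under eq_cvg do rewrite /= sE//.
  by apply: one_sub_expr_cvg; rewrite ger0_norm ?sqr_ge0//; nra.
apply/(@negligible_integrable _ _ _ _ _ (~` I)) => //.
- exact: measurableC.
- by apply/measurable_EFinP; exact: measurable_inv_1B.
rewrite setTD setCK; apply/integrableP; split.
  by apply/measurable_EFinP; apply: measurable_funTS; exact: measurable_inv_1B.
have -> : (\int[nu]_(x in I) `|((1 - x)^-1)%:E| =
    \int[nu]_(x in I) limn (f^~ x))%E.
  apply: eq_integral => x; rewrite inE => Ix; rewrite lim_f//= ger0_norm//.
  by have [? ? _] := inI _ Ix; rewrite invr_ge0 subr_ge0 ltW.
apply: (@le_lt_trans _ _ B%:E); last exact: ltry.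
apply: (cvge_to_le (cvg_monotone_convergence mI mf f0 ndf)).
apply: nearW => n.
have -> : (\int[nu]_(x in I) f n x = (poly_integral _ nu (s n))%:E)%E.
  rewrite /poly_integral (Rintegral_concentrated _ _ _ mI nuI); last first.
    exact: integrable_horner.
  rewrite /Rintegral fineK//; apply: integrable_fin_num => //.
  by apply: integrableS (integrable_horner _ _ (s n) cnu).
by rewrite lee_fin; exact: SB.
Qed.

Section WithIntegrableInverse.
Variable nu : {finite_measure set (measurableTypeR R) -> \bar R}.
Hypothesis nuI : nu (~` I) = 0%E.
Hypothesis int_inv : nu.-integrable setT (fun x : R => ((1 - x)^-1)%:E).

Let cnu : compactly_supported nu.
Proof. exact: compactly_supported_itv _ _ (concentrated_closed _ nuI). Qed.

Let int_invI : nu.-integrable I (fun x : R => ((1 - x)^-1)%:E).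
Proof. by apply: integrableS int_inv. Qed.

Let int_hornerI (p : {poly R}) : nu.-integrable I (EFin \o horner p).
Proof. by apply: integrableS (integrable_horner _ _ p cnu). Qed.

Let poly_integralI (p : {poly R}) :
  poly_integral _ nu p = \int[nu]_(x in I) p.[x].
Proof.
apply: (Rintegral_concentrated _ _ _ mI nuI); exact: integrable_horner.
Qed.

Lemma sum_moments_cvg :
  poly_integral _ nu (\sum_(j < n) 'X^j) @[n --> \oo] -->
  \int[nu]_(x in I) (1 - x)^-1.
Proof.
under eq_cvg do rewrite poly_integralI.
apply: fine_cvg; rewrite fineK; last exact: integrable_fin_num.
(* On [I], [1 - x ^ n] is at most 2 in absolute value, so [2 / (1 - x)] dominates the geometric
   sums. *)
have int2 : nu.-integrable I (fun x : R => (2%:E * ((1 - x)^-1)%:E)%E).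
  exact: integrableZl.
have [|||||_ _ //] := @dominated_convergence _ _ _ nu I mI
  (fun n (x : measurableTypeR R) => ((\sum_(j < n) 'X^j : {poly R}).[x])%:E)
  (fun x => ((1 - x)^-1)%:E) (fun x => (2%:E * ((1 - x)^-1)%:E)%E).
- move=> n; apply/measurable_EFinP; apply: measurable_funTS.
  exact: measurable_horner.
- by apply/measurable_EFinP; apply: measurable_funTS; exact: measurable_inv_1B.
- apply: aeW => x Ix; apply/cvg_EFin; first exact: nearW.
  have [x1 x2 _] := inI _ Ix; under eq_cvg do rewrite /= geometric_sum_I//.
  by apply: one_sub_expr_cvg; rewrite ltr_norml x1.
- exact: int2.
apply: aeW => x n Ix; have [x1 x2 _] := inI _ Ix.
rewrite geometric_sum_I// lee_fin normrM [`|_^-1|]ger0_norm; last first.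
  by rewrite invr_ge0 subr_ge0 ltW.
apply: ler_wpM2r; first by rewrite invr_ge0 subr_ge0 ltW.
apply: (le_trans (ler_normB _ _)); rewrite normr1 normrX -[2]/(1 + 1) lerD2l.
by rewrite exprn_ile1// ler_norml !ltW.
Qed.

Lemma Rintegral_difference_kernel n :
  \int[nu]_(x in I) ((1 - x ^+ n) / (1 - x) ^+ 2) =
  n%:R * \int[nu]_(x in I) (1 - x)^-1 - \int[nu]_x Q n x.
Proof.
have -> : \int[nu]_x Q n x = poly_integral _ nu (q_poly R n).
  by rewrite /poly_integral; under [RHS]eq_Rintegral do rewrite horner_q_poly.
rewrite poly_integralI -RintegralZl//.
have intn : nu.-integrable I (EFin \o (fun x : measurableTypeR R => n%:R * (1 - x)^-1)).
  have := @integrableZl _ _ _ _ _ mI n%:R _ int_invI; exact.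
rewrite -RintegralB//.
apply: eq_Rintegral => x; rewrite inE => Ix; have [_ _ x1] := inI _ Ix.
by rewrite Q_closed_form// horner_q_poly.
Qed.

(** By [Rintegral_difference_kernel] the two formulas for [gamma] agree when [b] and [d] differ by
    the integral of [1 / (1 - x)]; that [{1}] is null follows from concentration on [I]. *)
Lemma difference_representation_triplet gamma d :
  difference_representation gamma nu d <->
  representing_triplet gamma (d - \int[nu]_(x in I) (1 - x)^-1) 0 nu.
Proof.
split=> [[_ _ gE]|[_ _ _ gE]].
  split => //.
    apply/eqP; rewrite -measure_le0 -nuI le_measure ?inE//.
      exact: measurableC.
    by move=> _ -> /inI[_]; rewrite ltxx.
  move=> n; rewrite [LHS]gE Rintegral_difference_kernel; ring.
split => // n; rewrite [LHS]gE Rintegral_difference_kernel; ring.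
Qed.

Lemma difference_representation_telescope_cvg gamma d :
  difference_representation gamma nu d -> telescope gamma @ \oo --> d.
Proof.
move=> /difference_representation_triplet T.
have -> : telescope gamma = fun n => d - \int[nu]_(x in I) (1 - x)^-1 +
    poly_integral _ nu (\sum_(j < n) 'X^j).
  apply/funext => n; rewrite (representing_triplet_telescope _ _ _ _ _ _ T).
  by rewrite mul0r addr0.
rewrite -[X in _ --> X](subrK (\int[nu]_(x in I) (1 - x)^-1)).
by apply: cvgD; [exact: cvg_cst|exact: sum_moments_cvg].
Qed.

End WithIntegrableInverse.

End DifferenceRepresentation.

(** * From sequences to representations and back *)

Lemma cvg_triplet_difference_representation (R : realType) (gamma : R^nat) (b c : R)
    (nu : {finite_measure set (measurableTypeR R) -> \bar R}) :
  cvgn (telescope gamma) -> representing_triplet gamma b c nu ->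
  [/\ c = 0, nu.-integrable setT (fun x : R => ((1 - x)^-1)%:E) &
      difference_representation gamma nu
        (b + \int[nu]_(x in `]-1, 1[) (1 - x)^-1)].
Proof.
move=> cg T; have [c0 cnu nu1 _] := T.
have [c_eq0 nuI] : c = 0 /\ nu (~` `]-1, 1[%classic) = 0%E.
  apply: concentrated_of_moments_cvg => //.
  under eq_cvg do rewrite -(representing_triplet_second_diff _ _ _ _ _ _ T).
  exact: second_diff_cvg0.
rewrite c_eq0 in T *.
have int_inv : nu.-integrable setT (fun x : R => ((1 - x)^-1)%:E).
  have [B [_ hB]] := cvg_seq_bounded cg.
  (* The first differences are at most [B + 1], since boundedness supplies every bound strictly
     above [B]; they exceed the integrals of geometric sums by [b]. *)
  apply: (@integrable_inv_1B _ _ (B + 1 - b)) => // n.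
  have := hB (B + 1) ltac:(by rewrite ltrDl) n Logic.I.
  rewrite /= (representing_triplet_telescope _ _ _ _ _ _ T) mul0r addr0.
  by move=> /(le_trans (ler_norm _)); lra.
split=> //; apply/difference_representation_triplet => //.
by rewrite addrK.
Qed.

(** The second differences are moments of [nu], so their functional at [q ^ 2] is the integral of a
    square. *)
Lemma difference_representation_cpd (R : realType) (gamma : R^nat) (d : R)
    (nu : {finite_measure set (measurableTypeR R) -> \bar R}) :
  difference_representation gamma nu d -> cpd gamma.
Proof.
move=> D; have [nuI int_inv _] := D.
have T := (difference_representation_triplet _ _ nuI int_inv _ _).1 D.
have [_ cnu _ _] := T.
apply/cpdP => q.
pose M := poly_integral_scalar _ _ cnu.
have -> : moment_functional _ (second_diff _ gamma) (q ^+ 2) = M (q ^+ 2).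
  rewrite (scalar_polyE _ M); apply: eq_bigr => i _; congr (_ * _).
  by rewrite (representing_triplet_second_diff _ _ _ _ _ _ T) mulr0 add0r.
by apply: Rintegral_ge0 => x _; rewrite horner_exp sqr_ge0.
Qed.

Lemma cpd_cvg_triplet (R : realType) (gamma : R^nat) :
  cpd gamma -> cvgn (telescope gamma) ->
  exists (nu : {finite_measure set (measurableTypeR R) -> \bar R}),
    representing_triplet gamma (gamma 1%N - gamma 0%N) 0 nu.
Proof.
move=> /cpdP sq0 cg.
have d0 := second_diff_cvg0 _ _ cg.
have [B [_ hB]] := cvg_seq_bounded (cvgP _ d0).
have LB n : `|moment_functional _ (second_diff _ gamma) 'X^n| <= B + 1.
  by rewrite moment_functionalXn; apply: hB => //; rewrite ltrDl.
have [nu nu1 mom] := exists_measure_of_functional _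
  (moment_functional R (second_diff _ gamma))
  (ge0_on_itv _ _ (B + 1) sq0 LB).
have cnu := compactly_supported_itv _ _ nu1.
have momX n : second_diff _ gamma n = poly_integral _ nu 'X^n.
  by rewrite -mom /= moment_functionalXn.
exists nu; apply: representing_triplet_of_moments => //.
(* So far [nu] lives on the closed interval; moments tending to 0 remove the end points, with [c]
   taken to be 0. *)
have [_ nuI] : (0 : R) = 0 /\ nu (~` `]-1, 1[%classic) = 0%E.
  apply: concentrated_of_moments_cvg => //.
  by under eq_cvg do rewrite mulr0 add0r -momX.
apply/eqP; rewrite -measure_le0 -nuI le_measure ?inE//.
  by apply: measurableC; exact: measurable_itv.
by move=> _ -> /=; rewrite in_itv/= ltxx andbF.
Qed.

Theorem theorem2p3p2 (R : realType) (gamma : R^nat) :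
  [/\ (* (i) <-> (ii) *)
      cpd gamma /\ cvgn (telescope gamma) <->
      (exists (nu : {finite_measure set (measurableTypeR R) -> \bar R})
              (d : R), difference_representation gamma nu d),
      (* (iii) *)
      forall (b c : R)
             (nu : {finite_measure set (measurableTypeR R) -> \bar R}),
        cpd gamma -> cvgn (telescope gamma) ->
        representing_triplet gamma b c nu ->
        let d := b + \int[nu]_(x in `]-1, 1[) (1 - x)^-1 in
        [/\ c = 0,
            nu.-integrable setT (fun x : R => ((1 - x)^-1)%:E),
            difference_representation gamma nu d &
            forall (nu' : {finite_measure set (measurableTypeR R) -> \bar R})
                   (d' : R),
              difference_representation gamma nu' d' ->
              d' = d /\
              (forall A : set (measurableTypeR R),
                 measurable A -> nu' A = nu A)] &
      (* (iv) *)
      forall (nu : {finite_measure set (measurableTypeR R) -> \bar R}) (d : R),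
        difference_representation gamma nu d ->
        telescope gamma @ \oo --> d /\
        representing_triplet gamma
          (d - \int[nu]_(x in `]-1, 1[) (1 - x)^-1) 0 nu].
Proof.
have iv (nu : {finite_measure set (measurableTypeR R) -> \bar R}) (d : R) :
    difference_representation gamma nu d -> telescope gamma @ \oo --> d /\
    representing_triplet gamma
      (d - \int[nu]_(x in `]-1, 1[) (1 - x)^-1) 0 nu.
  move=> D; have [nuI int_inv _] := D; split.
    exact: difference_representation_telescope_cvg D.
  exact/difference_representation_triplet.
split=> //; first split.
- move=> [pg cg]; have [nu T] := cpd_cvg_triplet _ _ pg cg.
  have [_ _ D] := cvg_triplet_difference_representation _ _ _ _ _ cg T.
  by exists nu; eexists; exact: D.
- move=> [nu [d D]]; split; first exact: difference_representation_cpd D.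
  by apply/cvg_ex; exists d; case: (iv _ _ D).
move=> b c nu pg cg T d.
have [c0 int_inv D] := cvg_triplet_difference_representation _ _ _ _ _ cg T.
split=> // nu' d' D'.
(* Both [d] and [d'] are limits of the first differences. Both triplets have [c = 0], so both
   measures have the second differences of [gamma] as moments. *)
have [cvg_d T1] := iv _ _ D; have [cvg_d' T'] := iv _ _ D'.
split; first exact: (cvg_unique _ cvg_d' cvg_d).
have [nuI _ _] := D; have [nuI' _ _] := D'.
apply: measure_eq_of_moments; [exact: concentrated_closed..|move=> n].
have mE (m : {finite_measure set (measurableTypeR R) -> \bar R}) :
    \int[m]_x (x ^+ n) = poly_integral _ m 'X^n.
  by rewrite /poly_integral; under [RHS]eq_Rintegral do rewrite hornerXn.
rewrite !mE; have := representing_triplet_second_diff _ _ _ _ _ n T1.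
by rewrite (representing_triplet_second_diff _ _ _ _ _ n T') !mulr0 !add0r.
Qed.
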